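(* Let $G=(G^1,\dots,G^N)\in(W_0(\mathbb{R}))^N$ have stable integer shifts and let $\vec\Lambda=(\Lambda^1,\dots,\Lambda^N)$ be a tuple of separated subsets of $\mathbb{R}$. Then the following are equivalent: (a) $\vec\Lambda$ is a sampling set for $V^p(G)$ for some $p\in[1,\infty]$; (b) $\vec\Lambda$ is a sampling set for $V^p(G)$ for all $p\in[1,\infty]$; (c) every weak limit $\vec\Gamma\in W_{\mathbb{Z}}(\vec\Lambda)$ is a sampling set for $V^\infty(G)$; (d) every weak limit $\vec\Gamma\in W_{\mathbb{Z}}(\vec\Lambda)$ is a set of uniqueness for $V^\infty(G)$.
   Context: $W_0(\mathbb{R})$ is the space of continuous $g:\mathbb{R}\to\mathbb{C}$ with $\sum_{k\in\mathbb{Z}}\max_{x\in[k,k+1]}|g(x)|<\infty$. For $G=(G^1,\dots,G^N)$, $V^p(G)=\{\sum_{k\in\mathbb{Z}}c_kG(\cdot-k):c\in\ell^p(\mathbb{Z})\}\subseteq(L^p(\mathbb{R}))^N$ with norm $\|F\|_p=(\sum_{j=1}^N\|F^j\|_p^p)^{1/p}$ for $p<\infty$ and $\|F\|_\infty=\max_j\|F^j\|_\infty$. $G$ has stable integer shifts if $\|\sum_kc_kG(\cdot-k)\|_p\asymp\|c\|_p$ (two-sided bounds with constants independent of $c$) for $c\in\ell^p(\mathbb{Z})$, $1\le p\le\infty$. A set is separated if distinct points have mutual distance bounded below by a positive constant. $\vec\Lambda$ is a sampling set for $V^p(G)$ if $\|F\|_p\asymp(\sum_{j=1}^N\sum_{\lambda\in\Lambda^j}|F^j(\lambda)|^p)^{1/p}$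 for all $F\in V^p(G)$ (for $p=\infty$: $\|F\|_\infty\asymp\max_j\sup_{\lambda\in\Lambda^j}|F^j(\lambda)|$). $\vec\Lambda$ is a uniqueness set for $V^p(G)$ if $F\in V^p(G)$ and $F^j\equiv0$ on $\Lambda^j$ for all $j$ imply $F\equiv0$. A sequence of sets $\Lambda_n\subseteq\mathbb{R}$ converges weakly to $\Lambda$ if for every bounded open interval $(a,b)$ and $\varepsilon>0$ there is $n_0$ such that for $n\ge n_0$: $\Lambda_n\cap(a,b)\subseteq\Lambda+(-\varepsilon,\varepsilon)$ and $\Lambda\cap(a,b)\subseteq\Lambda_n+(-\varepsilon,\varepsilon)$. $\vec\Gamma=(\Gamma^1,\dots,\Gamma^N)\in W_{\mathbb{Z}}(\vec\Lambda)$ if there is a sequence $(k_n)\subseteq\mathbb{Z}$ such that $\Lambda^j+k_n$ converges weakly to $\Gamma^j$ for all $1\le j\le N$ (same sequence for all $j$). *)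

(* Defs.v *)
From HB Require Import structures.
From mathcomp Require Import all_boot all_order all_algebra.
From mathcomp Require Import all_classical all_reals all_analysis.
From mathcomp Require Import complex.
Set Implicit Arguments. Unset Strict Implicit. Unset Printing Implicit Defensive.
Import Order.TTheory GRing.Theory Num.Theory.
Import numFieldTopology.Exports numFieldNormedType.Exports.
Import ComplexField.
Local Open Scope classical_set_scope.
Local Open Scope ring_scope.

(* the usual metric topology on C = R[i] (induced by the modulus) *)
HB.instance Definition _ (R : realType) := NormedModule.copy R[i] (R[i])^o.

Section Defs.
Variable R : realType.
Local Notation C := (complex R).
Local Notation modc := (@Normc.normc R).

Definition rint (k : int) : R := k%:~R.

(* Sum over k in Z, as the limit of the symmetric partial sums
   \sum_{k=-n}^{n} a k (all series below are absolutely convergent). *)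
Definition zsum (a : int -> C) : C :=
  lim ((fun n : nat => \sum_(0 <= i < (2 * n).+1) a (i%:Z - n%:Z)) @ \oo).

Definition W0 (g : R -> C) : Prop :=
  continuous g /\
  (\esum_(k in [set: int])
     ereal_sup [set (modc (g x))%:E | x in `[rint k, (rint k + 1)%R]] < +oo)%E.

Definition lpnorm (p : \bar R) (c : int -> C) : \bar R :=
  match p with
  | r%:E => ((\esum_(k in [set: int]) ((modc (c k))%:E `^ r)) `^ r^-1)%E
  | _ => ereal_sup [set (modc (c k))%:E | k in [set: int]]
  end.

Definition synth (N : nat) (G : 'I_N -> R -> C) (c : int -> C) : 'I_N -> R -> C :=
  fun j x => zsum (fun k => c k * G j (x - rint k)).

Definition vLnorm (N : nat) (p : \bar R) (F : 'I_N -> R -> C) : \bar R :=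
  let n j := Lnorm (@lebesgue_measure R) p (fun x => (modc (F j x))%:E) in
  match p with
  | r%:E => ((\sum_(j < N) n j `^ r) `^ r^-1)%E
  | _ => (\big[maxe/0%E]_(j < N) n j)%E
  end.

Definition sampnorm (N : nat) (p : \bar R) (Lam : 'I_N -> set R)
    (F : 'I_N -> R -> C) : \bar R :=
  match p with
  | r%:E => ((\sum_(j < N) \esum_(l in Lam j) ((modc (F j l))%:E `^ r)) `^ r^-1)%E
  | _ => (\big[maxe/0%E]_(j < N) ereal_sup [set (modc (F j l))%:E | l in Lam j])%E
  end.

Definition inV (N : nat) (p : \bar R) (G : 'I_N -> R -> C) (F : 'I_N -> R -> C) :=
  exists c : int -> C, (lpnorm p c < +oo)%E /\ F = synth G c.

Definition stable_shifts (N : nat) (G : 'I_N -> R -> C) : Prop :=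
  forall p : \bar R, (1 <= p)%E ->
  exists A B : R, 0 < A /\ 0 < B /\
    forall c : int -> C, (lpnorm p c < +oo)%E ->
      (A%:E * lpnorm p c <= vLnorm p (synth G c))%E /\
      (vLnorm p (synth G c) <= B%:E * lpnorm p c)%E.

Definition separated_set (L : set R) : Prop :=
  exists d : R, 0 < d /\ forall x y, L x -> L y -> x != y -> d <= `|x - y|.

Definition sampling_set (N : nat) (p : \bar R) (G : 'I_N -> R -> C)
    (Lam : 'I_N -> set R) : Prop :=
  exists A B : R, 0 < A /\ 0 < B /\
    forall F, inV p G F ->
      (A%:E * vLnorm p F <= sampnorm p Lam F)%E /\
      (sampnorm p Lam F <= B%:E * vLnorm p F)%E.

Definition uniqueness_set (N : nat) (p : \bar R) (G : 'I_N -> R -> C)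
    (Lam : 'I_N -> set R) : Prop :=
  forall F, inV p G F -> (forall j l, Lam j l -> F j l = 0) ->
    forall j x, F j x = 0.

Definition thicken (L : set R) (e : R) : set R :=
  [set x | exists2 y, L y & `|x - y| < e].

Definition weak_cvg (Ln : nat -> set R) (L : set R) : Prop :=
  forall a b e : R, 0 < e -> exists n0 : nat, forall n, (n0 <= n)%N ->
    (Ln n `&` `]a, b[ `<=` thicken L e) /\ (L `&` `]a, b[ `<=` thicken (Ln n) e).

Definition WZ (N : nat) (Lam Gam : 'I_N -> set R) : Prop :=
  exists k : nat -> int, forall j,
    weak_cvg (fun n => [set l + rint (k n) | l in Lam j]) (Gam j).

End Defs.

(* Main.v *)
Require Import Defs.
From HB Require Import structures.
From mathcomp Require Import all_boot all_order all_algebra.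
From mathcomp Require Import all_classical all_reals all_analysis.
From mathcomp Require Import complex.
From mathcomp Require Import ring lra zify.
Set Implicit Arguments. Unset Strict Implicit. Unset Printing Implicit Defensive.
Import Order.TTheory GRing.Theory Num.Theory.
Import numFieldTopology.Exports numFieldNormedType.Exports.
Import ComplexField.
Local Open Scope classical_set_scope.
Local Open Scope ring_scope.

(** Stability of the integer shifts turns every norm of [F = synth G c] into the norm of [c], so
    sampling for [p] means that the operator [c |-> (|F j x|)_{j, x in Lam j}] is bounded below
    on l^p.  Its matrix is dominated by a summable convolution kernel [w], and grouping the
    samples by unit cells ([cellsup]) moves everything to sequences on the integers.

    Independence of [p]: multiply [c] by a Lipschitz cutoff of width [r] around [x], use the lower
    bound in l^p for the truncated (finitely supported) sequence, and take the l^q norm in [x].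
    The commutator of the cutoff with the operator has norm at most
    [sum_n w n * min 1 (|n| / r)], which tends to 0 as [r] grows, so it is absorbed in the mixed
    norm [l^q_x (l^p (window of c around x))].

    Only finitely supported sequences are tested, and for these the lower bound in l^oo passes to
    weak limits, which gives (b) -> (c).  If the lower bound in l^oo fails, translates of almost
    extremal sequences and of [Lam] converge along an ultrafilter to a nonzero [c] whose
    synthesis vanishes on a weak limit of [Lam], which gives (d) -> (a). *)

(** * Sums of nonnegative extended reals over arbitrary index sets *)

Section esum_extra.
Context {R : realType}.
Local Open Scope ereal_scope.

(** The factor [t] may be infinite, as happens when it is itself an l^p norm. *)
Lemma le_esumZl (T : choiceType) (A : set T) (t : \bar R) (a : T -> \bar R) :
  0 <= t -> (forall i, 0 <= a i) ->
  \esum_(i in A) (t * a i) <= t * \esum_(i in A) a i.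
Proof.
move=> t0 a0; apply: ge_ereal_sup => /= _ [X [finX XA]] <-.
rewrite -ge0_mule_fsumr//; apply: lee_wpmul2l => //.
by apply: ereal_sup_ubound; exists X.
Qed.

Lemma esumZl (T : choiceType) (A : set T) (t : R) (a : T -> \bar R) :
  (0 <= t)%R -> (forall i, 0 <= a i) ->
  \esum_(i in A) (t%:E * a i) = t%:E * \esum_(i in A) a i.
Proof.
move=> t0 a0; apply/eqP; rewrite eq_le le_esumZl//=.
have [<-|{}t0] : (0 = t \/ 0 < t)%R by apply/predU1P; rewrite -le_eqVlt.
  by rewrite mul0e esum_ge0// => i _; rewrite mul0e.
rewrite -lee_pdivlMl//; apply: le_trans (le_esumZl _ _ _).
- by apply: le_esum => i _; rewrite muleA -EFinM mulVf ?gt_eqF// mul1e.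
- by rewrite lee_fin invr_ge0 ltW.
- by move=> i; rewrite mule_ge0// lee_fin ltW.
Qed.

Lemma le_esum_term (T : choiceType) (A : set T) (a : T -> \bar R) i :
  A i -> a i <= \esum_(i in A) a i.
Proof.
move=> Ai; apply: esum_ge; exists [set i]; last by rewrite fsbig_set1.
by split => [|j ->]; [exact: finite_set1|].
Qed.

Lemma esum_swap (T1 T2 : choiceType) (a : T1 -> T2 -> \bar R) :
  (forall i j, 0 <= a i j) ->
  \esum_(i in [set: T1]) \esum_(j in [set: T2]) a i j =
  \esum_(j in [set: T2]) \esum_(i in [set: T1]) a i j.
Proof.
move=> a0; rewrite !esum_esum//.
rewrite (@reindex_esum R _ _ ([set: T2] `*`` (fun=> [set: T1]))
   ([set: T1] `*`` (fun=> [set: T2])) (fun x => (x.2, x.1)))//.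
by split => //= [[? ?] [? ?] _ _ [-> ->]//|[i j] _]; exists (j, i).
Qed.

Lemma le_esum_subset (T : choiceType) (A B : set T) (a : T -> \bar R) :
  (forall i, 0 <= a i) -> A `<=` B ->
  \esum_(i in A) a i <= \esum_(i in B) a i.
Proof.
move=> a0 AB; apply: ge_ereal_sup => /= _ [X [finX XA]] <-.
by apply: ereal_sup_ubound; exists X => //; split => // i /XA /AB.
Qed.

End esum_extra.

(** * Tangent line inequalities for powers *)

Section tangent.
Context {R : realType}.

(** Convexity: [u]^ r[lies above its tangent at]t[. This is Young's inequality for]u[and]t
    [^ (r - 1)] with exponents [r] and [r / (r - 1)]; at [r = 1] the conjugate exponent is infinite,
    hence the separate case. *)
Lemma powR_tangent (r t u : R) : 1 <= r -> 0 <= t -> 0 <= u ->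
  r * t `^ (r - 1) * u <= u `^ r + (r - 1) * t `^ r.
Proof.
move=> r1 t0 u0; move: r1; rewrite le_eqVlt => /predU1P[<-|r1].
  by rewrite subrr powRr0 powRr1// !mul1r mul0r addr0.
have rp : 0 < r by lra.
have r1p : 0 < r - 1 by lra.
have := @conjugate_powR R u (t `^ (r - 1)) r (r / (r - 1)) u0 (powR_ge0 _ _) rp.
move=> /(_ (divr_gt0 rp r1p)); rewrite -powRrM.
rewrite [(r - 1) * _]mulrC divfK ?gt_eqF// invf_div => H.
have /H : r^-1 + (r - 1) / r = 1.
  by rewrite -[X in X + _]mul1r -mulrDl addrC subrK divff ?gt_eqF.
move/(ler_wpM2l (ltW rp)); rewrite [r * (u * _)]mulrCA [u * _]mulrC => /le_trans->//.
by rewrite le_eqVlt; apply/orP; left; apply/eqP; field; rewrite gt_eqF.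
Qed.

Lemma powR_subK (x r : R) : 0 < x -> x `^ (r - 1) * x = x `^ r.
Proof.
by move=> x0; rewrite -{2}[x]powRr1 ?ltW// -powRD ?subrK// (gt_eqF x0) implybT.
Qed.

(** The tangent inequality at the ratio [u / s], multiplied by the weight [s]. A zero weight forces
    [u = 0], and both sides then vanish because division by 0 gives 0. *)
Lemma powR_tangent_scaled (r t u s : R) : 1 <= r -> 0 <= t -> 0 <= u <= s ->
  r * t `^ (r - 1) * u <= s * (u / s) `^ r + (r - 1) * t `^ r * s.
Proof.
move=> r1 t0 /andP[u0 us]; have [s0|s0] := eqVneq s 0.
  have -> : u = 0 by apply/eqP; rewrite eq_le u0 andbT -s0.
  by rewrite s0 !mulr0 mul0r addr0.
have sp : 0 < s by rewrite lt_neqAle eq_sym s0 (le_trans u0).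
have := powR_tangent r1 t0 (divr_ge0 u0 (ltW sp)).
move/(ler_wpM2l (ltW sp)); rewrite mulrDr [X in _ <= _ + X]mulrC => le1.
by apply: le_trans le1; rewrite [leRHS]mulrC -!mulrA mulVf// mulr1.
Qed.

End tangent.

(** * The l^p norms of nonnegative families and Minkowski's inequality *)

Section lnorm.
Context {R : realType}.
Local Open Scope ereal_scope.

(** Extended real values allow a norm of norms without finiteness conditions. By conversion
    [lpnorm p c] is [lnorm p (cmod c)], with [cmod] the sequence of moduli defined below. *)
Definition lnorm (T : choiceType) (p : \bar R) (f : T -> \bar R) : \bar R :=
  match p with
  | r%:E => (\esum_(k in [set: T]) (f k `^ r)) `^ r^-1
  | _ => ereal_sup (range f)
  end.

Lemma ge1_ind (P : \bar R -> Prop) :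
  (forall r : R, (1 <= r)%R -> P r%:E) -> P +oo -> forall p, 1 <= p -> P p.
Proof. by move=> Pr Py [r| |]//; rewrite lee_fin => /Pr. Qed.

Lemma lee_poweR (r : R) (x y : \bar R) : (0 <= r)%R -> 0 <= x -> x <= y -> x `^ r <= y `^ r.
Proof.
move=> r0 x0 xy; apply: gt0_ler_poweR => //; rewrite in_itv/= leey andbT//.
exact: le_trans xy.
Qed.

Lemma poweRVK (r : R) (x : \bar R) : (0 < r)%R -> 0 <= x -> (x `^ r) `^ r^-1 = x.
Proof. by move=> r0 x0; rewrite -poweRrM divff ?gt_eqF// poweRe1. Qed.

Lemma poweRKV (r : R) (x : \bar R) : (0 < r)%R -> 0 <= x -> (x `^ r^-1) `^ r = x.
Proof. by move=> r0 x0; rewrite -poweRrM mulVf ?gt_eqF// poweRe1. Qed.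

Variable T : choiceType.
Implicit Types f g : T -> \bar R.

Lemma le_lnorm p f g : 1 <= p -> (forall k, 0 <= f k) ->
  (forall k, f k <= g k) -> lnorm p f <= lnorm p g.
Proof.
move=> + f0 fg; elim/ge1_ind => [r r1|] /=.
  have r0 : (0 <= r)%R by lra.
  apply: lee_poweR; rewrite ?invr_ge0//.
    by apply: esum_ge0 => *; exact: poweR_ge0.
  by apply: le_esum => k _; exact: lee_poweR.
by apply: ge_ereal_sup => _ [k _ <-]; apply: (le_trans (fg k)); apply: ereal_sup_ubound; exists k.
Qed.

Lemma lnorm_ge p f k : 1 <= p -> (forall k, 0 <= f k) -> f k <= lnorm p f.
Proof.
move=> + f0; elim/ge1_ind => [r r1|] /=; last by apply: ereal_sup_ubound; exists k.
have r0 : (0 < r)%R by lra.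
rewrite -{1}[f k](@poweRVK r)//; apply: lee_poweR; rewrite ?invr_ge0 ?(ltW r0)//.
  exact: poweR_ge0.
exact: (@le_esum_term _ _ _ (fun k => f k `^ r)).
Qed.

Lemma lnorm_ge0 p f (k : T) : 1 <= p -> (forall k, 0 <= f k) -> 0 <= lnorm p f.
Proof. by move=> p1 f0; apply: le_trans (lnorm_ge k p1 f0). Qed.

Lemma lnormZ_le p f (t : R) : 1 <= p -> (0 <= t)%R -> (forall k, 0 <= f k) ->
  lnorm p (fun k => t%:E * f k) <= t%:E * lnorm p f.
Proof.
move=> + t0 f0; elim/ge1_ind => [r r1|] /=.
  have r0 : (0 < r)%R by lra.
  rewrite -{2}[t%:E](@poweRVK r)// -poweRM ?poweR_ge0//; last first.
    by apply: esum_ge0 => *; exact: poweR_ge0.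
  apply: lee_poweR; rewrite ?invr_ge0 ?(ltW r0)//.
    by apply: esum_ge0 => *; exact: poweR_ge0.
  under eq_esum do rewrite poweRM//.
  by apply: le_esumZl => *; exact: poweR_ge0.
apply: ge_ereal_sup => _ [k _ <-]; apply: lee_wpmul2l => //.
by apply: ereal_sup_ubound; exists k.
Qed.

Lemma lnorm_delta p (y : T) (t : \bar R) : 1 <= p -> 0 <= t ->
  lnorm p (fun k => if k == y then t else 0) <= t.
Proof.
move=> + t0; elim/ge1_ind => [r r1|] /=; last first.
  by apply: ge_ereal_sup => _ [k _ <-]; case: ifP.
have r0 : (0 < r)%R by lra.
rewrite (_ : \esum_(k in _) _ = t `^ r) ?poweRVK//.
rewrite (eq_esum (b := fun k => if k \in [set y] then t `^ r else 0)); last first.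
  move=> k _; case: eqP => [->|/eqP ky]; first by rewrite mem_set.
  by rewrite memNset ?poweR0r ?gt_eqF//=; exact/eqP.
by rewrite -esum_mkcondl setIT esum_set1//; exact: poweR_ge0.
Qed.

Lemma lnorm_reindex p f (s : T -> T) : bijective s -> lnorm p (f \o s) = lnorm p f.
Proof.
move=> bs; have sb : set_bij [set: T] [set: T] s.
  case: bs => s' ss' s's; split => //; first by move=> x y _ _; exact: (can_inj ss').
  by move=> x _; exists (s' x).
have rE : range (f \o s) = range f.
  case: bs => s' ss' s's; apply/seteqP; split => [_ [k _ <-]|_ [k _ <-]]; first by exists (s k).
  by exists (s' k) => //=; rewrite s's.
by case: p => [r| |] /=; rewrite ?rE// [in RHS](reindex_esum _ _ _ _ sb).
Qed.

(* Jensen's inequality with weights [lnorm p (f n)], obtained by summing [powR_tangent_scaled]. *)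
Lemma lnorm_esum (I : choiceType) p (f : I -> T -> \bar R) (k0 : T) :
  1 <= p -> (forall n k, 0 <= f n k) ->
  lnorm p (fun k => \esum_(n in [set: I]) f n k) <= \esum_(n in [set: I]) lnorm p (f n).
Proof.
move=> p1 f0; move: p1 (p1); elim/ge1_ind => [r r1|] p1; last first.
  apply: ge_ereal_sup => _ [k _ <-]; apply: le_esum => n _.
  by apply: ereal_sup_ubound; exists k.
have r0 : (0 < r)%R by lra.
set S := \esum_(n in _) lnorm _ _.
have [->|Sy] := eqVneq S +oo; first exact: leey.
have S0 : 0 <= S by apply: esum_ge0 => n _; exact: (lnorm_ge0 k0).
have Sfin : S \is a fin_num by rewrite ge0_fin_numE// ltey.
have [s sE] : exists s : I -> R, forall n, lnorm r%:E (f n) = (s n)%:E.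
  exists (fun n => fine (lnorm r%:E (f n))) => n; rewrite fineK// ge0_fin_numE ?(lnorm_ge0 k0)//.
  rewrite (@le_lt_trans _ _ S)//; last by rewrite ltey.
  exact: (@le_esum_term _ _ _ (fun n => lnorm r%:E (f n))).
have s0 n : (0 <= s n)%R by rewrite -lee_fin -sE (lnorm_ge0 k0).
have fs n k : f n k <= (s n)%:E by rewrite -sE; exact: lnorm_ge.
have [u uE] : exists u : I -> T -> R, forall n k, f n k = (u n k)%:E.
  exists (fun n k => fine (f n k)) => n k; rewrite fineK// ge0_fin_numE//.
  by rewrite (le_lt_trans (fs n k))// ltry.
have u0 n k : (0 <= u n k)%R by rewrite -lee_fin -uE.
have us n k : (u n k <= s n)%R by rewrite -lee_fin -uE.
(* The convex term of [powR_tangent_scaled] with weight [s n]; its sum over [k] is at most [s n]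
   because [s n] is the l^r norm of [f n]. *)
pose h n k := (s n * (u n k / s n) `^ r)%R%:E : \bar R.
have h0 n k : 0 <= h n k by rewrite lee_fin mulr_ge0// powR_ge0.
have SE : S = \esum_(n in [set: I]) (s n)%:E by apply: eq_esum => n _.
have [S' S'E] : exists S', S = S'%:E by exists (fine S); rewrite fineK.
have S'0 : (0 <= S')%R by rewrite -lee_fin -S'E.
have hs n : \esum_(k in [set: T]) h n k <= (s n)%:E.
  have [sn0|sn0] := eqVneq (s n) 0%R.
    by rewrite esum1 ?sn0// => k _; rewrite /h sn0 mul0r.
  rewrite /h; under eq_esum do rewrite EFinM.
  rewrite esumZl//; last by move=> k; rewrite lee_fin powR_ge0.
  rewrite -[leRHS]mule1; apply: lee_wpmul2l; rewrite ?lee_fin//.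
  under eq_esum do rewrite powRM ?invr_ge0// mulrC EFinM -(poweR_EFin (u _ _)) -uE.
  rewrite esumZl ?powR_ge0//; last by move=> k; exact: poweR_ge0.
  rewrite -[X in _ * X](@poweRKV r)//; last by apply: esum_ge0 => *; exact: poweR_ge0.
  have /= -> := sE n.
  by rewrite poweR_EFin -EFinM lee_fin -powRM ?invr_ge0// mulVf// powR1.
have key k : (\esum_(n in [set: I]) f n k) `^ r <=
    (S' `^ (r - 1))%:E * \esum_(n in [set: I]) h n k.
  set H := \esum_(n in _) h _ _.
  have H0 : 0 <= H by apply: esum_ge0.
  have US : \esum_(n in [set: I]) f n k <= S by rewrite SE; apply: le_esum.
  have U0 : 0 <= \esum_(n in [set: I]) f n k by apply: esum_ge0.
  have [U UE] : exists U, \esum_(n in [set: I]) f n k = U%:E.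
    exists (fine (\esum_(n in [set: I]) f n k)); rewrite fineK// ge0_fin_numE//.
    by rewrite (le_lt_trans US)// ltey.
  rewrite UE in US U0 *; rewrite S'E !lee_fin in US U0.
  have [U00|Un0] := eqVneq U 0%R.
    by rewrite U00 poweR0r ?gt_eqF// mule_ge0// lee_fin powR_ge0.
  have Up : (0 < U)%R by rewrite lt_neqAle eq_sym Un0.
  have Sp : (0 < S')%R by exact: lt_le_trans US.
  pose t := (U / S')%R.
  have t0 : (0 < t)%R by exact: divr_gt0.
  have : \esum_(n in [set: I]) ((r * t `^ (r - 1))%:E * f n k) <=
         \esum_(n in [set: I]) (h n k + ((r - 1) * t `^ r)%:E * (s n)%:E).
    apply: le_esum => n _; rewrite uE /h -!EFinM -EFinD lee_fin.
    by apply: powR_tangent_scaled => //; rewrite ?u0 ?us// ltW.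
  have c0 : (0 <= (r - 1) * t `^ r)%R by rewrite mulr_ge0 ?powR_ge0//; lra.
  rewrite esumD//; last by move=> n _; rewrite -EFinM lee_fin mulr_ge0.
  rewrite (esumZl _ c0)// -SE S'E esumZl//; last by rewrite mulr_ge0 ?powR_ge0 ?ltW.
  rewrite UE -!EFinM => le1.
  have tE : (t `^ (r - 1) * U = t `^ r * S')%R.
    by rewrite -(powR_subK r t0) -mulrA /t divfK ?gt_eqF.
  have le2 : (t `^ r * S')%:E <= H.
    move: le1; rewrite -mulrA tE -/H.
    case: (H) H0 => [x| |]; rewrite ?leey// -EFinD !lee_fin => _; lra.
  have -> : U%:E `^ r = (S' `^ (r - 1))%:E * (t `^ r * S')%:E.
    rewrite poweR_EFin -EFinM mulrCA (powR_subK _ Sp) -powRM ?ltW//.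
    by rewrite /t divfK ?gt_eqF.
  by apply: lee_wpmul2l => //; rewrite lee_fin powR_ge0.
rewrite -[leRHS](@poweRVK r)//=; apply: lee_poweR; rewrite ?invr_ge0 ?(ltW r0)//.
  by apply: esum_ge0 => *; exact: poweR_ge0.
apply: (le_trans (le_esum (fun k _ => key k))).
rewrite esumZl ?powR_ge0//; last by move=> k; apply: esum_ge0.
rewrite esum_swap//.
apply: (@le_trans _ _ ((S' `^ (r - 1))%:E * S)).
  by apply: lee_wpmul2l; rewrite ?lee_fin ?powR_ge0// SE; apply: le_esum.
rewrite S'E poweR_EFin -EFinM lee_fin.
have [S'00|S'n0] := eqVneq S' 0%R; first by rewrite S'00 mulr0 powR_ge0.
by rewrite powR_subK// lt_neqAle eq_sym S'n0.
Qed.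

(** The triangle inequality is [lnorm_esum] for families indexed by [bool]. *)
Lemma lnormD p f g (k0 : T) : 1 <= p -> (forall k, 0 <= f k) -> (forall k, 0 <= g k) ->
  lnorm p (fun k => f k + g k) <= lnorm p f + lnorm p g.
Proof.
move=> p1 f0 g0; pose h (b : bool) := if b then f else g.
have bE (F : bool -> \bar R) : (forall b, 0 <= F b) ->
    \esum_(b in [set: bool]) F b = F true + F false.
  move=> F0; rewrite (esumID [set true])// !setTI esum_set1//; congr (_ + _).
  rewrite (_ : ~` _ = [set false]) ?esum_set1//.
  by apply/seteqP; split => [[]//= /(_ erefl)//|[]//=].
have h0 b k : 0 <= h b k by case: b => /=.
have := lnorm_esum k0 p1 h0.
rewrite bE; last by move=> b; apply: (lnorm_ge0 k0).
by under [X in lnorm _ X <= _ -> _]funext do rewrite bE//.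
Qed.

End lnorm.

(** * Tails of summable families *)

Section tails.
Context {R : realType}.
Local Open Scope ereal_scope.

Lemma esum_tail (T : choiceType) (w : T -> \bar R) (e : R) :
  (forall n, 0 <= w n) -> \esum_(n in [set: T]) w n < +oo -> (0 < e)%R ->
  exists2 X, finite_set X & \esum_(n in ~` X) w n <= e%:E.
Proof.
move=> w0 wy e0; have wfin : \esum_(n in [set: T]) w n \is a fin_num.
  by rewrite ge0_fin_numE// esum_ge0.
have [_ [Y [finY _] <-] HY] := ub_ereal_sup_adherent e0 wfin.
exists Y => //; move: HY; rewrite -/(esum _ _) (esumID Y)// setTI setTI.
rewrite (esum_fset finY)//.
have SYfin : \sum_(i \in Y) w i \is a fin_num.
  rewrite -esum_fset// ge0_fin_numE ?esum_ge0//.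
  by apply: le_lt_trans wy; exact: le_esum_subset.
have Cfin : \esum_(n in ~` Y) w n \is a fin_num.
  rewrite ge0_fin_numE ?esum_ge0//.
  by apply: le_lt_trans wy; exact: le_esum_subset.
rewrite -(fineK SYfin) -(fineK Cfin); set s := fine _; set t := fine _.
change ((s + t - e)%:E < s%:E -> t%:E <= e%:E); rewrite lte_fin lee_fin => ?; lra.
Qed.

Lemma esum_int_tail (w : int -> \bar R) (e : R) :
  (forall n, 0 <= w n) -> \esum_(n in [set: int]) w n < +oo -> (0 < e)%R ->
  exists m : nat, \esum_(n in [set n : int | (m < `|n|)%N]) w n <= e%:E.
Proof.
move=> w0 wy e0; have [X finX HX] := esum_tail w0 wy e0.
have /finite_seqP[xs XE] := finX.
exists (\max_(n <- xs) `|n|)%N; apply: le_trans HX; apply: le_esum_subset => //.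
move=> n /= mn; rewrite XE => xsn; move: mn; rewrite ltnNge => /negP; apply.
exact: (@leq_bigmax_seq _ _ xpredT (fun n : int => `|n|%N)).
Qed.

(** Dominated convergence made explicit: beyond some [m] the tail of [w] is small, and for
    [|n| <= m] the damping factor is at most [m / r]. *)
Lemma esum_damped (w : int -> R) (e : R) :
  (forall n, 0 <= w n)%R -> \esum_(n in [set: int]) (w n)%:E < +oo -> (0 < e)%R ->
  exists2 r : nat, (0 < r)%N &
    \esum_(n in [set: int]) (w n * Num.min 1 (`|rint R n| / r%:R))%:E <= e%:E.
Proof.
move=> w0 wy e0; have e20 : (0 < e / 2)%R by rewrite divr_gt0.
have w0E n : 0 <= (w n)%:E by rewrite lee_fin.
have [m Hm] := esum_int_tail w0E wy e20.
have [S SE] : exists S, \esum_(n in [set: int]) (w n)%:E = S%:E.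
  exists (fine (\esum_(n in [set: int]) (w n)%:E)).
  by rewrite fineK// ge0_fin_numE// esum_ge0.
have S0 : (0 <= S)%R by rewrite -lee_fin -SE esum_ge0.
(* Chosen so that [m / r * S <= e / 2]; the successor makes [r] positive. *)
pose r := (Num.bound (2 * m%:R * S / e)).+1.
exists r => //.
have r0 : (0 < r%:R :> R)%R by rewrite ltr0n.
apply: (@le_trans _ _ (\esum_(n in [set: int])
   ((if n \in [set n : int | (m < `|n|)%N] then (w n)%:E else 0) + (m%:R / r%:R)%:E * (w n)%:E))).
  apply: le_esum => n _; case: ifPn.
    move=> _; rewrite -EFinM -EFinD lee_fin.
    apply: (@le_trans _ _ (w n)); first by rewrite ler_piMr// ge_min lexx.
    by rewrite lerDl mulr_ge0// divr_ge0.
  rewrite notin_setE/= => /negP; rewrite -leqNgt => nm.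
  rewrite add0e -EFinM lee_fin mulrC ler_wpM2r// ge_min; apply/orP; right.
  rewrite ler_wpM2r ?invr_ge0 ?(ltW r0)//.
  by rewrite /rint -intr_norm -abszE -pmulrn ler_nat.
rewrite esumD//; last 2 first.
- by move=> n _; case: ifP.
- by move=> n _; rewrite -EFinM lee_fin mulr_ge0// divr_ge0.
rewrite -esum_mkcondl setIT esumZl ?divr_ge0// SE.
apply: (le_trans (leeD2r _ Hm)); rewrite -EFinM -EFinD lee_fin.
suff : (m%:R / r%:R * S <= e / 2)%R by lra.
rewrite mulrAC ler_pdivrMr//.
have : (2 * m%:R * S / e < r%:R)%R.
  rewrite (lt_le_trans (archi_boundP _))// ?divr_ge0 ?mulr_ge0 ?(ltW e0)//.
  by rewrite /r ler_nat.
rewrite ltr_pdivrMr//; lra.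
Qed.

End tails.

(** * Windows of a sequence and mixed norms *)

Section window.
Context {R : realType}.
Local Open Scope ereal_scope.

Definition window (b : int -> \bar R) (r : nat) (x k : int) : \bar R :=
  if (`|k - x| <= r)%N then b k else 0.

Lemma window_ge0 b r x k : (forall k, 0 <= b k) -> 0 <= window b r x k.
Proof. by move=> b0; rewrite /window; case: ifP. Qed.

Lemma finite_window (r : nat) : finite_set [set n : int | (`|n| <= r)%N].
Proof.
apply: (@sub_finite_set _ _ ((fun i : nat => i%:Z - r%:Z)%R @` `I_(2 * r).+1)).
  move=> n /= nr; exists (absz (n + r%:Z)%R); lia.
exact/finite_image/finite_II.
Qed.

Lemma bij_shift (n : int) : bijective (fun k : int => k + n)%R.
Proof. by exists (fun k => k - n)%R => k; rewrite ?addrK ?subrK. Qed.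

(** A window is a sum of point masses, one for each offset [n] with [|n| <= r]. Minkowski in l^p and
    then in l^q, together with translation invariance, gives the number of offsets as constant,
    uniformly in [p] and [q]. *)
Lemma lnorm_window (r : nat) : exists2 X : R, (0 <= X)%R &
  forall p q (b : int -> \bar R), 1 <= p -> 1 <= q -> (forall k, 0 <= b k) ->
  lnorm q (fun x => lnorm p (window b r x)) <= X%:E * lnorm q b.
Proof.
pose A := [set n : int | (`|n| <= r)%N].
pose chi (n : int) : R := (n \in A)%:R.
have chi0 n : (0 <= chi n)%R by rewrite /chi ler0n.
have chiy : \esum_(n in [set: int]) (chi n)%:E < +oo.
  rewrite (eq_esum (b := fun n => if n \in A then 1 else 0)); last first.
    by move=> n _; rewrite /chi; case: ifP.
  rewrite -esum_mkcondl setIT esum_fset//; last exact: finite_window.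
  by apply/lte_sum_pinfty => *; rewrite ltry.
have chi0E : 0 <= \esum_(n in [set: int]) (chi n)%:E by apply: esum_ge0 => *; rewrite lee_fin.
exists (fine (\esum_(n in [set: int]) (chi n)%:E)); first exact: fine_ge0.
move=> p q b p1 q1 b0; rewrite fineK ?ge0_fin_numE//.
have cb0 n y : 0 <= (chi n)%:E * b y by rewrite mule_ge0// lee_fin.
apply: (@le_trans _ _ (lnorm q (fun x => \esum_(n in [set: int]) ((chi n)%:E * b (x + n)%R)))).
  apply: le_lnorm => // x; first by apply: (lnorm_ge0 0%R) => // k; exact: window_ge0.
  apply: (@le_trans _ _ (lnorm p (fun l => \esum_(n in [set: int])
     (if l == (x + n)%R then (chi n)%:E * b (x + n)%R else 0)))).
    apply: le_lnorm => // l; first exact: window_ge0.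
    apply: le_trans (le_esum_term (i := (l - x)%R) _ _) => //=.
    rewrite addrC subrK eqxx /window /chi; case: ifPn => lx; last exact: cb0.
    by rewrite mem_set// mul1e.
  apply: (le_trans (lnorm_esum 0%R _ _)) => //; first by move=> n l; case: ifP.
  by apply: le_esum => n _; apply: lnorm_delta.
apply: (le_trans (lnorm_esum 0%R _ _)) => //.
rewrite muleC; apply: le_trans (le_esumZl _ _ _); last 2 first.
- exact: (lnorm_ge0 0%R).
- by move=> n; rewrite lee_fin.
apply: le_esum => n _; apply: (le_trans (lnormZ_le _ _ _)) => //.
rewrite muleC; apply: lee_wpmul2r; first by rewrite lee_fin.
by rewrite (lnorm_reindex q b (bij_shift n)).
Qed.

(** The window of radius [2 * r] around [x] is covered by those of radius [r] around [x - r] and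
    [x + r]. The factor 2 does not depend on [r], so it survives the later choice of a large [r]. *)
Lemma lnorm_window_double p q (b : int -> \bar R) r : 1 <= p -> 1 <= q -> (forall k, 0 <= b k) ->
  lnorm q (fun x => lnorm p (window b (2 * r) x)) <=
  2%:E * lnorm q (fun x => lnorm p (window b r x)).
Proof.
move=> p1 q1 b0; pose m x := lnorm p (window b r x).
have m0 x : 0 <= m x by apply: (lnorm_ge0 0%R) => // k; exact: window_ge0.
apply: (@le_trans _ _ (lnorm q (fun x => m (x + - r%:Z)%R + m (x + r%:Z)%R))).
  apply: le_lnorm => // x; first by apply: (lnorm_ge0 0%R) => // k; exact: window_ge0.
  apply: le_trans (lnormD 0%R p1 _ _); last 2 first.
  - by move=> k; exact: window_ge0.
  - by move=> k; exact: window_ge0.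
  apply: le_lnorm => // k; first exact: window_ge0.
  have w0 y : 0 <= window b r y k by exact: window_ge0.
  rewrite {1}/window; case: ifPn => kx; last exact: adde_ge0.
  have [kx1|kx1] := boolP (absz (k - (x + - r%:Z))%R <= r)%N.
    by rewrite {1}/window kx1 leeDl.
  rewrite [X in _ + X]/window ifT ?leeDr//; lia.
apply: (le_trans (lnormD 0%R q1 _ _)) => //.
rewrite (lnorm_reindex q m (bij_shift (- r%:Z)%R)) (lnorm_reindex q m (bij_shift r)).
by rewrite mule_natl mule2n.
Qed.

End window.

(** * The modulus of complex numbers as a real number *)

Section modulus.
Context {R : realType}.
Local Notation C := (complex R).
Local Notation modc := (@Normc.normc R).
Implicit Types z : C.

Lemma modc_ge0 z : 0 <= modc z.
Proof. by case: z => a b; exact: sqrtr_ge0. Qed.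

Lemma modc_real (t : R) : modc t%:C%C = `|t|.
Proof. by rewrite /= expr0n addr0 sqrtr_sqr. Qed.

Lemma normC_modc z : `|z| = (modc z)%:C%C.
Proof. by rewrite normc_def; case: z. Qed.

Lemma modcD z1 z2 : modc (z1 + z2) <= modc z1 + modc z2.
Proof. exact: le_normcD. Qed.

Lemma modcN z : modc (- z) = modc z.
Proof. exact: normcN. Qed.

Lemma modc_sum (I : Type) (s : seq I) (P : pred I) (f : I -> C) :
  modc (\sum_(i <- s | P i) f i) <= \sum_(i <- s | P i) modc (f i).
Proof.
elim/big_ind2: _ => [|x1 x2 y1 y2 h1 h2|//]; first by rewrite Normc.normc0.
by rewrite (le_trans (modcD _ _))// lerD.
Qed.

Lemma Re_le_modc z : `|complex.Re z| <= modc z.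
Proof. by case: z => a b /=; rewrite -sqrtr_sqr ler_wsqrtr// lerDl sqr_ge0. Qed.

Lemma Im_le_modc z : `|complex.Im z| <= modc z.
Proof. by case: z => a b /=; rewrite -sqrtr_sqr ler_wsqrtr// lerDr sqr_ge0. Qed.

Lemma modc_le_ReIm z : modc z <= `|complex.Re z| + `|complex.Im z|.
Proof.
have {1}-> : z = (complex.Re z)%:C%C + 'i%C * (complex.Im z)%:C%C by exact: complexE.
rewrite (le_trans (modcD _ _))// Normc.normcM !modc_real.
by rewrite (_ : modc 'i%C = 1) ?mul1r//= expr0n expr1n add0r sqrtr1.
Qed.

End modulus.

(** * Lipschitz cutoffs on the integers *)

Section cutoff.
Context {R : realType}.

(** A trapezoid: plateau 1 up to distance [r] from [x], then slope [1 / r] down to 0 at distance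
    [2 * r]. *)
Definition cutoff (r : nat) (x k : int) : R :=
  Num.max 0 (Num.min 1 (2 - `|rint R (k - x)| / r%:R)).

Lemma rint_absz (k : int) : `|rint R k| = `|k|%N%:R.
Proof. by rewrite /rint -intr_norm -abszE -pmulrn. Qed.

Lemma cutoff_ge0 r x k : 0 <= cutoff r x k.
Proof. by rewrite /cutoff le_max lexx. Qed.

Lemma cutoff_le1 r x k : cutoff r x k <= 1.
Proof. by rewrite /cutoff ge_max ler01 ge_min lexx. Qed.

Lemma cutoff1 r x k : (0 < r)%N -> (`|k - x| <= r)%N -> cutoff r x k = 1.
Proof.
move=> r0 kx; rewrite /cutoff rint_absz.
have : (`|(k - x)%R|%:R / r%:R <= 1 :> R) by rewrite ler_pdivrMr ?ltr0n// mul1r ler_nat.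
move=> h; rewrite min_l; last by lra.
by rewrite max_r.
Qed.

Lemma cutoff0 r x k : (0 < r)%N -> (2 * r < `|k - x|)%N -> cutoff r x k = 0.
Proof.
move=> r0 kx; rewrite /cutoff rint_absz.
have : (2 <= `|(k - x)%R|%:R / r%:R :> R).
  by rewrite ler_pdivlMr ?ltr0n// -natrM ler_nat ltnW.
move=> h; rewrite min_r; last by lra.
by rewrite max_l//; lra.
Qed.

Lemma clamp_lip (u v d : R) : u <= d + v -> v <= d + u ->
  `|Num.max 0 (Num.min 1 (2 - u)) - Num.max 0 (Num.min 1 (2 - v))| <= d.
Proof.
move=> h1 h2; rewrite ler_norml.
case: (leP 1 (2 - u)) => ?; case: (leP 1 (2 - v)) => ?; rewrite ?(max_r ler01);
  try (case: (leP 0 (2 - u)) => ?); try (case: (leP 0 (2 - v)) => ?);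
  apply/andP; split; lra.
Qed.

(** The slope gives the second entry of the minimum, the range [0, 1] the first. The minimum is the
    damping factor of [esum_damped]. *)
Lemma cutoff_lip r x k l : (0 < r)%N ->
  `|cutoff r x k - cutoff r x l| <= Num.min 1 (`|rint R (k - l)| / r%:R).
Proof.
move=> r0; rewrite le_min; apply/andP; split.
  rewrite ler_norml; have := cutoff_ge0 r x k; have := cutoff_ge0 r x l.
  have := cutoff_le1 r x k; have := cutoff_le1 r x l; move=> *; apply/andP; split; lra.
have r0' : 0 < r%:R :> R by rewrite ltr0n.
rewrite /cutoff; set u := `|rint R (k - x)| / _; set v := `|rint R (l - x)| / _.
set d := `|rint R (k - l)| / _.
have h1 : u <= d + v.
  rewrite /u /d /v -mulrDl ler_pM2r ?invr_gt0//.
  by rewrite (le_trans _ (ler_normD _ _))// /rint -intrD addrA subrK.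
have h2 : v <= d + u.
  rewrite /u /d /v -mulrDl ler_pM2r ?invr_gt0// -[X in _ <= X + _]normrN.
  rewrite (le_trans _ (ler_normD _ _))// /rint -mulrNz -intrD opprB addrA subrK//.
exact: clamp_lip.
Qed.

End cutoff.

(** * Lower bounds do not depend on the exponent *)

Section stability.
Context {R : realType}.
Local Notation C := (complex R).
Local Notation modc := (@Normc.normc R).
Local Open Scope ereal_scope.
Implicit Types c : int -> C.

Definition cmod c (k : int) : \bar R := (modc (c k))%:E.

Definition finsupp c := exists K : nat, forall k : int, (K < `|k|)%N -> c k = 0%R.

Lemma cmod_ge0 c k : 0 <= cmod c k.
Proof. by rewrite lee_fin modc_ge0. Qed.

(** The class [P] of test sequences is a parameter because the transfer starts from finitely
    supported sequences and ends with all of l^q. *)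
Definition bounded_below (p : \bar R) (P : (int -> C) -> Prop) (D : (int -> C) -> int -> \bar R) :=
  exists2 A : R, (0 < A)%R & forall c, P c -> lnorm p (cmod c) <= A%:E * lnorm p (D c).

Variables (w : int -> R) (D : (int -> C) -> int -> \bar R).
Hypothesis w0 : forall n, (0 <= w n)%R.
Hypothesis wy : \esum_(n in [set: int]) (w n)%:E < +oo.
Hypothesis D0 : forall c l, 0 <= D c l.
(** The commutator of [D] with multiplication by [phi] is dominated by the kernel [w] times the
    increments of [phi]. Through this property the slow variation of the cutoff becomes a small
    error. *)
Hypothesis D_commutator : forall c (phi : int -> R) l, lnorm +oo (cmod c) < +oo ->
  (forall k, 0 <= phi k <= 1)%R ->
  D (fun k => (phi k)%:C%C * c k)%R l <= (phi l)%:E * D c l +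
    \esum_(n in [set: int]) ((w n * `|phi (l - n) - phi l|)%:E * cmod c (l - n)%R).

Lemma lnorm_le_oo q c : 1 <= q -> lnorm +oo (cmod c) <= lnorm q (cmod c).
Proof.
move=> q1; apply: ge_ereal_sup => _ [k _ <-]; apply: lnorm_ge => // *; exact: cmod_ge0.
Qed.

Section local_bound.
Variables (p q : \bar R) (r : nat) (c : int -> C).
Hypotheses (p1 : 1 <= p) (q1 : 1 <= q) (r0 : (0 < r)%N) (cq : lnorm q (cmod c) < +oo).
Let a := cmod c.
Let th n := (w n * Num.min 1 (`|rint R n| / r%:R))%R.
Let m x := lnorm p (window a r x).
Let m2 x := lnorm p (window a (2 * r) x).

Let a0 k : 0 <= a k. Proof. exact: cmod_ge0. Qed.
Let m0 x : 0 <= m x. Proof. by apply: (lnorm_ge0 0%R) => // k; exact: window_ge0. Qed.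
Let m20 x : 0 <= m2 x. Proof. by apply: (lnorm_ge0 0%R) => // k; exact: window_ge0. Qed.
Let th0 n : (0 <= th n)%R.
Proof. by rewrite mulr_ge0// le_min ler01 divr_ge0. Qed.

Let comm x l := \esum_(n in [set: int])
  ((w n * `|cutoff r x (l - n) - cutoff r x l : R|)%:E * a (l - n)%R).

Lemma comm_ge0 x l : 0 <= comm x l.
Proof. by apply: esum_ge0 => n _; rewrite mule_ge0// lee_fin mulr_ge0. Qed.

(** The increment of the cutoff vanishes unless [l - n] or [l] is within [2 * r] of [x]. In the
    second case [l - n] is within [2 * r] of [x - n], so [a (l - n)] is always seen through one of
    two windows. *)
Lemma lnorm_commutator x :
  lnorm p (comm x) <= \esum_(n in [set: int]) ((th n)%:E * (m2 x + m2 (x - n)%R)).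
Proof.
pose g n l := (th n)%:E * (window a (2 * r) x (l - n)%R + window a (2 * r) (x - n)%R (l - n)%R).
have W0 y k : 0 <= window a (2 * r) y k by exact: window_ge0.
have g0 n l : 0 <= g n l by rewrite mule_ge0 ?lee_fin// adde_ge0.
apply: (@le_trans _ _ (lnorm p (fun l => \esum_(n in [set: int]) g n l))).
  apply: le_lnorm => // l; first exact: comm_ge0.
  apply: le_esum => n _; rewrite /g.
  have [h|] := boolP ((2 * r < absz (l - n - x)%R) && (2 * r < absz (l - x)%R))%N.
    case/andP: h => h1 h2; rewrite !cutoff0// subrr normr0 mulr0 mul0e.
    by rewrite mule_ge0 ?lee_fin// adde_ge0.
  rewrite negb_and -!leqNgt => h.
  apply: (@le_trans _ _ ((th n)%:E * a (l - n)%R)).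
    apply: lee_wpmul2r => //; rewrite lee_fin ler_wpM2l//.
    apply: (le_trans (cutoff_lip _ _ _ r0)).
    rewrite (_ : l - n - l = - n)%R; last by rewrite addrAC subrr add0r.
    by rewrite /rint mulrNz normrN.
  apply: lee_wpmul2l; first by rewrite lee_fin.
  case/orP: h => h.
    by apply: (le_trans _ (leeDl _ (W0 _ _))); rewrite /window h.
  apply: (le_trans _ (leeDr _ (W0 _ _))).
  by rewrite /window (_ : l - n - (x - n) = l - x)%R ?h//; lia.
apply: (le_trans (lnorm_esum 0%R p1 g0)); apply: le_esum => n _.
apply: (le_trans (lnormZ_le p1 (th0 n) _)) => [l|]; first by rewrite adde_ge0.
apply: lee_wpmul2l; first by rewrite lee_fin.
apply: (le_trans (lnormD 0%R p1 _ _)) => //.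
by rewrite !(lnorm_reindex p (window a (2 * r) _) (bij_shift (- n)%R)).
Qed.

(** The lower bound is applied to [c] times the cutoff around [x], and the l^q norm in [x] is taken.
    The commutator brings [m] back on the right with a factor proportional to [th1], ready for
    absorption. *)
Lemma local_bound (A X th1 : R) : (0 < A)%R -> (0 <= X)%R ->
  (forall c', finsupp c' -> lnorm p (cmod c') <= A%:E * lnorm p (D c')) ->
  (forall b : int -> \bar R, (forall k, 0 <= b k) ->
    lnorm q (fun x => lnorm p (window b (2 * r) x)) <= X%:E * lnorm q b) ->
  \esum_(n in [set: int]) (th n)%:E <= th1%:E ->
  lnorm q m <= (A * X)%:E * lnorm q (D c) + (A * (4 * th1))%:E * lnorm q m.
Proof.
move=> A0 X0 HA HX Hth.
have th10 : (0 <= th1)%R by rewrite -lee_fin (le_trans _ Hth)// esum_ge0// => *; rewrite lee_fin.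
have W0 y k : 0 <= window (D c) (2 * r) y k by exact: window_ge0.
have WD0 y : 0 <= lnorm p (window (D c) (2 * r) y) by apply: (lnorm_ge0 0%R).
pose s x := \esum_(n in [set: int]) ((th n)%:E * (m2 x + m2 (x - n)%R)).
have s0 x : 0 <= s x by apply: esum_ge0 => n _; rewrite mule_ge0 ?lee_fin// adde_ge0.
have step1 x : m x <= A%:E * (lnorm p (window (D c) (2 * r) x) + s x).
  pose c' k := ((cutoff r x k)%:C%C * c k)%R.
  have c'E k : cmod c' k = (cutoff r x k)%:E * a k.
    rewrite /cmod Normc.normcM -[RHS]EFinM; congr (_%:E * _%:E)%E.
    by rewrite modc_real ger0_norm// cutoff_ge0.
  apply: (@le_trans _ _ (lnorm p (cmod c'))).
    apply: le_lnorm => // k; first exact: window_ge0.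
    rewrite /window; case: ifPn => kx; last exact: cmod_ge0.
    by rewrite c'E cutoff1// mul1e.
  apply: (le_trans (HA _ _)).
    exists (`|x| + 2 * r)%N => k kx; rewrite /c' cutoff0// ?mul0r//; lia.
  apply: lee_wpmul2l; first by rewrite lee_fin ltW.
  apply: (@le_trans _ _ (lnorm p (fun l => window (D c) (2 * r) x l + comm x l))).
    apply: le_lnorm => // l.
    apply: (le_trans (D_commutator _ _ _)).
    - exact: le_lt_trans (lnorm_le_oo _ _) cq.
    - by move=> k; rewrite cutoff_ge0 cutoff_le1.
    apply: leeD2r; rewrite /window; case: ifPn => [lx|].
      by rewrite -[leRHS]mul1e; apply: lee_wpmul2r => //; rewrite lee_fin cutoff_le1.
    by rewrite -ltnNge => lx; rewrite cutoff0// mul0e.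
  apply: (le_trans (lnormD 0%R p1 _ _)) => //; first by move=> l; exact: comm_ge0.
  exact/leeD2l/lnorm_commutator.
apply: (le_trans (le_lnorm q1 m0 step1)).
apply: (le_trans (lnormZ_le q1 (ltW A0) _)); first by move=> x; rewrite adde_ge0.
(* The 4 comes from two windows of radius [2 * r], each costing a factor 2 by
   [lnorm_window_double]. *)
have sM : lnorm q s <= (4 * th1)%:E * lnorm q m.
  apply: (le_trans (lnorm_esum 0%R q1 _)).
    by move=> n x; rewrite mule_ge0 ?lee_fin// adde_ge0.
  apply: (@le_trans _ _ (\esum_(n in [set: int]) ((4%:E * lnorm q m) * (th n)%:E))).
    apply: le_esum => n _.
    apply: (le_trans (lnormZ_le q1 (th0 n) _)); first by move=> x; rewrite adde_ge0.
    rewrite [leRHS]muleC; apply: lee_wpmul2l; first by rewrite lee_fin.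
    apply: (le_trans (lnormD 0%R q1 _ _)) => //.
    rewrite (lnorm_reindex q m2 (bij_shift (- n)%R)).
    have m2m := lnorm_window_double r p1 q1 a0.
    apply: (le_trans (leeD m2m m2m)).
    rewrite -ge0_muleDl// -EFinD lee_wpmul2r//; first exact: (lnorm_ge0 0%R).
    by rewrite lee_fin; lra.
  have M0 : 0 <= 4%:E * lnorm q m by rewrite mule_ge0//; exact: (lnorm_ge0 0%R).
  apply: (le_trans (le_esumZl _ M0 _)); first by move=> n; rewrite lee_fin.
  apply: (le_trans (lee_wpmul2l M0 Hth)).
  by rewrite muleAC -EFinM.
apply: (le_trans (lee_wpmul2l _ (lnormD 0%R q1 _ _))) => //; first by rewrite lee_fin ltW.
apply: (le_trans (lee_wpmul2l _ (leeD (HX _ _) sM))) => //; first by rewrite lee_fin ltW.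
have q0 : 0 <= lnorm q (D c) by apply: (lnorm_ge0 0%R).
have M0 : 0 <= lnorm q m by apply: (lnorm_ge0 0%R).
by rewrite ge0_muleDr ?mule_ge0 ?lee_fin ?mulr_ge0// !muleA -!EFinM.
Qed.

End local_bound.

Theorem bounded_below_transfer p q : 1 <= p -> 1 <= q ->
  bounded_below p finsupp D ->
  bounded_below q (fun c => lnorm q (cmod c) < +oo) D.
Proof.
move=> p1 q1 [A A0 HA].
(* With this tolerance the factor [A * (4 * th1)] of [local_bound] is 1/2. *)
have e0 : (0 < (8 * A)^-1)%R by rewrite invr_gt0 mulr_gt0.
have [r r0 Hr] := esum_damped w0 wy e0.
have [X X0 HX] := @lnorm_window R (2 * r).
have [Y Y0 HY] := @lnorm_window R r.
(* The added 1 keeps the constant positive when [X] is 0. *)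
exists (2 * A * X + 1)%R; first by rewrite ltr_wpDl// !mulr_ge0// ltW.
move=> c cq; have := local_bound p1 q1 r0 cq A0 X0 HA (fun b => HX _ _ b p1 q1) Hr.
set M := lnorm q _; set L := lnorm q (D c).
have a0 k := cmod_ge0 c k.
have L0 : 0 <= L by apply: (lnorm_ge0 0%R).
have aM : lnorm q (cmod c) <= M.
  apply: le_lnorm => // x.
  have /(_ x) := @lnorm_ge R _ p (window (cmod c) r x) _ p1 (fun k => window_ge0 _ _ _ a0).
  by rewrite {1}/window subrr.
have M0 : 0 <= M by apply: le_trans aM; apply: (lnorm_ge0 0%R).
(* Absorbing half of [M] into the left side requires [M] to be finite. *)
have Mfin : M \is a fin_num.
  rewrite ge0_fin_numE//; apply: le_lt_trans (HY _ _ _ p1 q1 a0) _.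
  by rewrite lte_mul_pinfty.
have -> : (A * (4 * (8 * A)^-1) = 2^-1)%R by field; rewrite gt_eqF.
move=> HM; apply: (le_trans aM).
move: HM; rewrite -(fineK Mfin); case: (L) L0 => [l| |]//.
  rewrite -!EFinM -EFinD !lee_fin => l0 h.
  suff : (0 <= l)%R by move: h; lra.
  by [].
move=> _ _; rewrite gt0_muley ?leey// lte_fin ltr_wpDl// !mulr_ge0// ltW//.
Qed.

End stability.

(** * Absolutely convergent sums over the integers *)

Section zsum_theory.
Context {R : realType}.
Local Notation C := (complex R).
Local Notation modc := (@Normc.normc R).
Implicit Types a b : int -> C.

Definition asummable a := (\esum_(k in [set: int]) (modc (a k))%:E < +oo)%E.

Definition zpsum a (n : nat) : C := \sum_(0 <= i < (2 * n).+1) a (i%:Z - n%:Z).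

(** Pairing opposite indices turns symmetric partial sums into ordinary partial sums of a series
    over [nat], up to the central term. *)
Definition zpair a (j : nat) : C := a j.+1%:Z + a (- j.+1%:Z).

Lemma zpsumE a n : zpsum a n = a 0 + \sum_(0 <= j < n) zpair a j.
Proof.
elim: n => [|n IH]; first by rewrite /zpsum big_nat1 big_geq// [RHS]addr0; congr a; lia.
rewrite big_nat_recr//= addrA -IH /zpsum /zpair.
rewrite (_ : (2 * n.+1).+1 = (2 * n).+3)%N; last by rewrite mulnS.
rewrite big_nat_recr//= big_nat_recl//= sub0r.
rewrite addrC [RHS]addrCA; congr (_ + _); first by congr a; lia.
rewrite addrC; congr (_ + _).
by apply: eq_bigr => i _; congr a; lia.
Qed.

Definition ztail a (n : nat) : \bar R :=
  (\esum_(k in [set k : int | (n < `|k|)%N]) (modc (a k))%:E)%E.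

Lemma ztail_peel a n :
  (ztail a n = (modc (a n.+1%:Z))%:E + (modc (a (- n.+1%:Z)))%:E + ztail a n.+1)%E.
Proof.
have m0 k : (0 <= (modc (a k))%:E)%E by rewrite lee_fin modc_ge0.
rewrite /ztail (esumID [set n.+1%:Z])// -addeA; congr (_ + _)%E.
  rewrite (_ : _ `&` _ = [set n.+1%:Z]) ?esum_set1//.
  by apply/seteqP; split => [k [/= _ ->]//|k /= ->]; split => //=.
rewrite (esumID [set - n.+1%:Z])//; congr (_ + _)%E.
  rewrite (_ : _ `&` _ = [set - n.+1%:Z]) ?esum_set1//.
  by apply/seteqP; split => [k [/= _ ->]//|k /= ->]; split => //=; split => //=; lia.
congr esum; apply/seteqP; split => k /=; first by move=> [[]] *; lia.
by move=> nk; split; [split|]; lia.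
Qed.

Lemma ztail_ge0 a n : (0 <= ztail a n)%E.
Proof. by apply: esum_ge0 => k _; rewrite lee_fin modc_ge0. Qed.

Lemma sum_zpair_le a n m : (n <= m)%N ->
  ((\sum_(n <= j < m) modc (zpair a j))%:E <= ztail a n)%E.
Proof.
move=> nm; rewrite -(subnKC nm); move: (m - n)%N => d {m nm}; elim: d n => [|d IH] n.
  by rewrite addn0 big_geq// ztail_ge0.
rewrite addnS big_ltn ?ltnS ?leq_addr// ztail_peel EFinD; apply: leeD.
  by rewrite -EFinD lee_fin modcD.
by rewrite -addSn; exact: IH.
Qed.

Lemma asummable_tail a (e : R) : asummable a -> 0 < e ->
  exists n0, forall n, (n0 <= n)%N -> (ztail a n <= e%:E)%E.
Proof.
move=> sa e0; have m0 k : (0 <= (modc (a k))%:E)%E by rewrite lee_fin modc_ge0.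
have [n0 H] := esum_int_tail m0 sa e0; exists n0 => n n0n; apply: le_trans H.
by apply: le_esum_subset => // k /=; lia.
Qed.

(** Convergence with a real tolerance, in contrast to the complex tolerances of the norm on
    [R[i]]. *)
Definition zconv a (s : C) := forall e : R, 0 < e ->
  exists n0, forall n, (n0 <= n)%N -> modc (s - zpsum a n) <= e.

Lemma zconv_zsum a s : zconv a s -> zsum a = s.
Proof.
move=> H; apply: cvg_lim; first exact: norm_hausdorff.
(* The tolerance is a positive complex number, so its imaginary part is 0. *)
apply/cvgrPdist_le => /= e; rewrite ltcE/= => /andP[/eqP e2 e1].
have [n0 Hn] := H _ e1; exists n0 => // n /= /Hn.
by rewrite normC_modc lecE/= e2 eqxx.
Qed.

Lemma summable_real_series (u : nat -> R) (B : R) :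
  (forall n, \sum_(0 <= j < n) `|u j| <= B) ->
  exists s, forall e, 0 < e -> exists n0, forall n, (n0 <= n)%N ->
    `|s - \sum_(0 <= j < n) u j| <= e.
Proof.
move=> H; have cu : cvgn (series u).
  apply: normed_cvg; apply: nondecreasing_is_cvgn.
    by move=> m n mn; apply: (@nondecreasing_series _ (fun k => `|u k|) xpredT 0).
  by exists B => _ [n _ <-]; exact: H.
exists (limn (series u)) => e e0.
by have /cvgrPdist_le /(_ e e0)[n0 _ Hn] := cu; exists n0 => n /Hn.
Qed.

Lemma sum_Re (f : nat -> C) n :
  complex.Re (\sum_(0 <= j < n) f j) = \sum_(0 <= j < n) complex.Re (f j).
Proof.
elim: n => [|n IH]; first by rewrite !big_geq.
rewrite !big_nat_recr//= -IH.
by case: (\sum_(_ <= _ < _) _) => x y; case: (f n).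
Qed.

Lemma sum_Im (f : nat -> C) n :
  complex.Im (\sum_(0 <= j < n) f j) = \sum_(0 <= j < n) complex.Im (f j).
Proof.
elim: n => [|n IH]; first by rewrite !big_geq.
rewrite !big_nat_recr//= -IH.
by case: (\sum_(_ <= _ < _) _) => x y; case: (f n).
Qed.

(** Real and imaginary parts of the paired series converge separately, both being dominated by the
    moduli of the pairs. *)
Lemma asummable_zconv a : asummable a -> exists s, zconv a s.
Proof.
move=> sa; have t0y : (ztail a 0 < +oo)%E.
  by apply: le_lt_trans sa; apply: le_esum_subset => // k; rewrite lee_fin modc_ge0.
pose B := fine (ztail a 0).
have BE : ztail a 0 = B%:E by rewrite fineK// ge0_fin_numE// ztail_ge0.
have HB n : \sum_(0 <= j < n) modc (zpair a j) <= B.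
  by rewrite -lee_fin -BE; exact: sum_zpair_le.
have [s1 H1] : exists s, forall e, 0 < e -> exists n0, forall n, (n0 <= n)%N ->
    `|s - \sum_(0 <= j < n) complex.Re (zpair a j)| <= e.
  apply: (@summable_real_series _ B) => n; apply: le_trans (HB n).
  by apply: ler_sum => j _; exact: Re_le_modc.
have [s2 H2] : exists s, forall e, 0 < e -> exists n0, forall n, (n0 <= n)%N ->
    `|s - \sum_(0 <= j < n) complex.Im (zpair a j)| <= e.
  apply: (@summable_real_series _ B) => n; apply: le_trans (HB n).
  by apply: ler_sum => j _; exact: Im_le_modc.
exists (a 0 + (s1 +i* s2)%C) => e e0.
have e20 : 0 < e / 2 by rewrite divr_gt0.
have [n1 Hn1] := H1 _ e20; have [n2 Hn2] := H2 _ e20.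
exists (maxn n1 n2) => n; rewrite geq_max => /andP[/Hn1 h1 /Hn2 h2].
rewrite zpsumE opprD addrACA subrr add0r (le_trans (modc_le_ReIm _))//.
move: h1 h2; rewrite -sum_Re -sum_Im; case: (\sum_(_ <= _ < _) _) => x y /=; lra.
Qed.

Lemma zsumP a : asummable a -> zconv a (zsum a).
Proof. by move=> /asummable_zconv[s Hs]; rewrite (zconv_zsum Hs). Qed.

(** The sum is compared with a partial sum far beyond [n]; the pairs in between are bounded by the
    tail. *)
Lemma zsum_tail a n : asummable a -> ((modc (zsum a - zpsum a n))%:E <= ztail a n)%E.
Proof.
move=> sa; apply/lee_addgt0Pr => e e0.
have [n0 H] := zsumP sa e0.
have nm := leq_maxl n n0; have := H _ (leq_maxr n n0).
set m := maxn n n0 in nm *; move=> h1.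
have -> : zsum a - zpsum a n = (zpsum a m - zpsum a n) + (zsum a - zpsum a m).
  by ring.
apply: (@le_trans _ _ ((modc (zpsum a m - zpsum a n))%:E + e%:E)%E).
  by rewrite -EFinD lee_fin (le_trans (modcD _ _))// lerD2l.
apply: leeD2r; apply: le_trans (sum_zpair_le a nm); rewrite lee_fin.
rewrite !zpsumE opprD addrACA subrr add0r (big_cat_nat (n := n))//= addrAC subrr add0r.
exact: modc_sum.
Qed.

Lemma zsum_le a : asummable a ->
  ((modc (zsum a))%:E <= \esum_(k in [set: int]) (modc (a k))%:E)%E.
Proof.
move=> sa; have m0 k : (0 <= (modc (a k))%:E)%E by rewrite lee_fin modc_ge0.
rewrite (esumID [set 0])// setTI esum_set1// setTI.
have -> : ~` [set 0 : int] = [set k : int | (0 < `|k|)%N].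
  by apply/seteqP; split => k /=; lia.
apply: le_trans (leeD2l _ (zsum_tail 0 sa)).
rewrite -EFinD lee_fin -[X in modc X <= _](subrK (zpsum a 0)) addrC.
rewrite (le_trans (modcD _ _))// {1}zpsumE big_geq// addr0//.
Qed.

Lemma asummable_le a (g : int -> \bar R) : (forall k, (modc (a k))%:E <= g k)%E ->
  (\esum_(k in [set: int]) g k < +oo)%E -> asummable a.
Proof. by move=> ag; apply: le_lt_trans; exact: le_esum. Qed.

Lemma asummableZ (t : C) a : asummable a -> asummable (fun k => t * a k).
Proof.
move=> sa; have m0 k : (0 <= (modc (a k))%:E)%E by rewrite lee_fin modc_ge0.
apply: (@asummable_le _ (fun k => (modc t)%:E * (modc (a k))%:E)%E).
  by move=> k; rewrite -EFinM lee_fin Normc.normcM.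
by rewrite esumZl ?modc_ge0// lte_mul_pinfty// lee_fin modc_ge0.
Qed.

Lemma zsumB a b : asummable a -> asummable b ->
  zsum (fun k => a k - b k) = zsum a - zsum b.
Proof.
move=> sa sb; apply: zconv_zsum => e e0.
have e20 : 0 < e / 2 by rewrite divr_gt0.
have [n1 H1] := zsumP sa e20; have [n2 H2] := zsumP sb e20.
exists (maxn n1 n2) => n; rewrite geq_max => /andP[/H1 h1 /H2 h2].
have -> : zpsum (fun k => a k - b k) n = zpsum a n - zpsum b n by rewrite /zpsum sumrB.
have -> : zsum a - zsum b - (zpsum a n - zpsum b n) =
  (zsum a - zpsum a n) + - (zsum b - zpsum b n) by ring.
by rewrite (le_trans (modcD _ _))// modcN; lra.
Qed.

Lemma zsumZ (t : C) a : asummable a -> zsum (fun k => t * a k) = t * zsum a.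
Proof.
move=> sa; apply: zconv_zsum => e e0.
have t1 : 0 < modc t + 1 by rewrite ltr_wpDl// modc_ge0.
have [n1 H1] := zsumP sa (divr_gt0 e0 t1); exists n1 => n /H1 h1.
rewrite /zpsum -mulr_sumr -mulrBr Normc.normcM.
apply: (@le_trans _ _ ((modc t + 1) * modc (zsum a - zpsum a n))).
  by rewrite ler_wpM2r ?modc_ge0// lerDl.
by rewrite mulrC -ler_pdivlMr.
Qed.

Lemma asummable_shift (n : int) a : asummable a -> asummable (fun k => a (k + n)).
Proof.
rewrite /asummable => sa; have [g gK Kg] := bij_shift n.
rewrite -(@reindex_esum R _ _ [set: int] [set: int] (fun k => k + n) (fun k => (modc (a k))%:E))//.
by split => // [x y _ _ /addIr//|k _]; exists (k - n) => //=; rewrite subrK.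
Qed.

(** A shift changes each symmetric partial sum by two boundary terms, and both are bounded by a
    small tail. *)
Lemma zsum_shift1 a : asummable a -> zsum (fun k => a (k + 1)) = zsum a.
Proof.
move=> sa; apply: zconv_zsum => e e0.
have e40 : 0 < e / 4 by rewrite divr_gt0.
have [n1 H1] := zsumP sa e40; have [n2 H2] := asummable_tail sa e40.
exists (maxn n1 n2.+1) => n; rewrite geq_max => /andP[/H1 h1 n2n].
have -> : zpsum (fun k => a (k + 1)) n = zpsum a n + a n.+1%:Z - a (- n%:Z).
  rewrite /zpsum big_nat_recr//= [in RHS]big_nat_recl//= sub0r.
  rewrite (_ : forall x y z : C, x + y + z - x = y + z); last by move=> *; ring.
  by congr (_ + _); [apply: eq_bigr => i _|]; congr a; lia.
have big k : (n <= `|k|)%N -> modc (a k) <= e / 4.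
  move=> nk; rewrite -lee_fin; apply: le_trans (H2 n2 (leqnn _)).
  by apply: (@le_esum_term _ _ _ (fun k => (modc (a k))%:E)) => /=; lia.
have b1 : modc (a n.+1%:Z) <= e / 4 by apply: big; lia.
have b2 : modc (a (- n%:Z)) <= e / 4 by apply: big; lia.
have -> : zsum a - (zpsum a n + a n.+1%:Z - a (- n%:Z)) =
  (zsum a - zpsum a n) + (a (- n%:Z) - a n.+1%:Z) by ring.
have := modcD (zsum a - zpsum a n) (a (- n%:Z) - a n.+1%:Z).
have := modcD (a (- n%:Z)) (- a n.+1%:Z); rewrite modcN; lra.
Qed.

Lemma zsum_shift (n : int) a : asummable a -> zsum (fun k => a (k + n)) = zsum a.
Proof.
have nat_case (m : nat) b : asummable b -> zsum (fun k => b (k + m%:Z)) = zsum b.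
  move=> sb; elim: m => [|m IH]; first by congr zsum; apply/funext => k; rewrite addr0.
  rewrite -IH -[RHS]zsum_shift1; last exact: asummable_shift.
  by congr zsum; apply/funext => k; congr b; lia.
move=> sa; case: (intP n) => [|m|m]; [exact: (nat_case 0)|exact: nat_case|].
rewrite -[LHS](nat_case m.+1); last exact: asummable_shift.
by congr zsum; apply/funext => k; rewrite addrK.
Qed.

End zsum_theory.

(** * A summable majorant of the generators on unit cells *)

Section majorant.
Context {R : realType}.
Local Notation C := (complex R).
Local Notation modc := (@Normc.normc R).

Lemma floor_subz (x : R) (k : int) : Num.floor (x - rint R k) = Num.floor x - k.
Proof. by rewrite /rint -mulrNz floorDrz ?intr_int// intrKfloor. Qed.

(** Adding the cell suprema of all components gives one kernel for every [j]; its summability is the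
    defining condition of [W0]. *)
Lemma W0_majorant (N : nat) (G : 'I_N -> R -> C) : (forall j, W0 (G j)) ->
  exists w : int -> R, [/\ forall n, 0 <= w n,
    (\esum_(n in [set: int]) (w n)%:E < +oo)%E &
    forall j x, modc (G j x) <= w (Num.floor x)].
Proof.
move=> HG.
pose s j (n : int) := ereal_sup [set (modc (G j x))%:E | x in `[rint R n, (rint R n + 1)%R]].
have s0 j n : (0 <= s j n)%E.
  apply: (@le_trans _ _ (modc (G j (rint R n)))%:E); first by rewrite lee_fin modc_ge0.
  by apply: ereal_sup_ubound; exists (rint R n) => //=; rewrite in_itv/= lexx lerDl ler01.
have sy j : (\esum_(n in [set: int]) s j n < +oo)%E by case: (HG j).
have sfin j n : (s j n \is a fin_num).
  rewrite ge0_fin_numE//; apply: le_lt_trans (sy j).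
  exact: (@le_esum_term _ _ _ (s j)).
exists (fun n => \sum_(j < N) fine (s j n)); split.
- by move=> n; apply: sumr_ge0 => j _; exact: fine_ge0.
- rewrite (eq_esum (b := fun n => (\sum_(j < N) s j n)%E)); last first.
    by move=> n _; rewrite -sumEFin; apply: eq_bigr => j _; rewrite fineK.
  rewrite esum_sum//; apply/lte_sum_pinfty => j _; exact: sy.
- move=> j x; rewrite (bigD1 j)//=.
  apply: (@le_trans _ _ (fine (s j (Num.floor x)))); last first.
    by rewrite lerDl sumr_ge0// => i _; exact: fine_ge0.
  rewrite -lee_fin fineK//; apply: ereal_sup_ubound; exists x => //=.
  have := floor_itv x; rewrite in_itv/= /rint intrD => /andP[-> /ltW ->] //.
Qed.

End majorant.

(** * Bounds for the synthesis operator and its samples *)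

Section synthesis.
Context {R : realType}.
Local Notation C := (complex R).
Local Notation modc := (@Normc.normc R).
Local Open Scope ereal_scope.
Variables (N : nat) (G : 'I_N -> R -> C) (w : int -> R).
Hypothesis w0 : forall n, (0 <= w n)%R.
Hypothesis wy : \esum_(n in [set: int]) (w n)%:E < +oo.
Hypothesis Gw : forall j x, (modc (G j x) <= w (Num.floor x))%R.
Implicit Types (c : int -> C) (g : int -> \bar R) (Lam : 'I_N -> set R) (F : 'I_N -> R -> C).

Lemma esum_convolution (l : int) g :
  \esum_(k in [set: int]) ((w (l - k))%:E * g k) =
  \esum_(n in [set: int]) ((w n)%:E * g (l - n)%R).
Proof.
rewrite (@reindex_esum R _ _ [set: int] [set: int] (fun n => l - n)%R).
  by apply: eq_esum => n _; congr ((w _)%:E * _); lia.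
split => // [x y _ _|k _]; first by move=> /addrI/oppr_inj.
by exists (l - k)%R => //=; lia.
Qed.

Lemma bounded_modc c : lnorm +oo (cmod c) < +oo ->
  exists2 B : R, (0 <= B)%R & forall k, (modc (c k) <= B)%R.
Proof.
move=> cy; have c0 := lnorm_ge0 0%R (leey 1%:E) (cmod_ge0 c).
exists (fine (lnorm +oo (cmod c))); first exact: fine_ge0.
move=> k; rewrite -lee_fin fineK ?ge0_fin_numE//.
exact: (lnorm_ge k (leey 1%:E) (cmod_ge0 c)).
Qed.

Lemma modc_bounded c (B : R) : (forall k, (modc (c k) <= B)%R) ->
  lnorm +oo (cmod c) < +oo.
Proof.
move=> cB; apply: (@le_lt_trans _ _ B%:E); last exact: ltry.
by apply: ge_ereal_sup => _ [k _ <-]; rewrite lee_fin.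
Qed.

(** The real weight [t] lets one estimate serve the synthesis itself ([t = 1]), the cut off sequence
    ([t = phi]) and the commutator ([t k = phi k - phi l]). *)
Lemma synth_term_le c (t : int -> R) j x k :
  (modc ((t k)%:C%C * (c k * G j (x - rint R k))))%:E <=
  (w (Num.floor x - k))%:E * ((`|t k|)%:E * cmod c k).
Proof.
rewrite /cmod -!EFinM lee_fin !Normc.normcM modc_real mulrA [leLHS]mulrC.
rewrite ler_wpM2r ?mulr_ge0 ?modc_ge0//.
by have := Gw j (x - rint R k); rewrite floor_subz.
Qed.

Lemma zsum_weighted_asummable c (t : int -> R) j x : lnorm +oo (cmod c) < +oo ->
  (forall k, `|t k| <= 1)%R ->
  asummable (fun k => (t k)%:C%C * (c k * G j (x - rint R k)))%R.
Proof.
move=> /bounded_modc[B B0 cB] t1.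
apply: (@asummable_le _ _ (fun k => (w (Num.floor x - k))%:E * B%:E)).
  move=> k; apply: (le_trans (synth_term_le _ _ _ _ _)).
  apply: lee_wpmul2l; first by rewrite lee_fin.
  rewrite -EFinM lee_fin -[leRHS]mul1r ler_pM ?modc_ge0//.
rewrite esum_convolution; under eq_esum do rewrite muleC.
by rewrite esumZl// lte_mul_pinfty.
Qed.

Lemma synth_asummable c j x : lnorm +oo (cmod c) < +oo ->
  asummable (fun k => c k * G j (x - rint R k))%R.
Proof.
move=> cy; have := @zsum_weighted_asummable c (fun=> 1%R) j x cy.
under [X in asummable X]funext do rewrite rmorph1 mul1r.
by apply => k; rewrite normr1.
Qed.

Lemma zsum_weighted_le c (t : int -> R) j x : lnorm +oo (cmod c) < +oo ->
  (forall k, `|t k| <= 1)%R ->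
  (modc (zsum (fun k => (t k)%:C%C * (c k * G j (x - rint R k)))%R))%:E <=
  \esum_(n in [set: int]) ((w n * `|t (Num.floor x - n)|)%:E * cmod c (Num.floor x - n)%R).
Proof.
move=> cy t1; apply: (le_trans (zsum_le (zsum_weighted_asummable j x cy t1))).
apply: (le_trans (le_esum (fun k _ => synth_term_le c t j x k))).
rewrite (esum_convolution _ (fun k => `|t k|%:E * cmod c k)).
by apply: le_esum => n _; rewrite EFinM muleA.
Qed.

Lemma synth_le c j x : lnorm +oo (cmod c) < +oo ->
  (modc (synth G c j x))%:E <=
  \esum_(n in [set: int]) ((w n)%:E * cmod c (Num.floor x - n)%R).
Proof.
move=> cy; have := @zsum_weighted_le c (fun=> 1%R) j x cy.
under [X in zsum X]funext do rewrite rmorph1 mul1r.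
under eq_esum do rewrite normr1 mulr1.
by apply => k; rewrite normr1.
Qed.

(** Split [phi k = phi l + (phi k - phi l)] with [l] the cell of [x]: the constant part factors out
    of the sum, and the rest is dominated termwise by the kernel. *)
Lemma synth_commutator c (phi : int -> R) j x : lnorm +oo (cmod c) < +oo ->
  (forall k, 0 <= phi k <= 1)%R ->
  (modc (synth G (fun k => (phi k)%:C%C * c k)%R j x))%:E <=
  (phi (Num.floor x))%:E * (modc (synth G c j x))%:E +
  \esum_(n in [set: int]) ((w n * `|phi (Num.floor x - n) - phi (Num.floor x)|)%:E *
    cmod c (Num.floor x - n)%R).
Proof.
move=> cy phi01; set l := Num.floor x.
have -> : synth G (fun k => (phi k)%:C%C * c k)%R j x =
  ((phi l)%:C%C * synth G c j x +
   zsum (fun k => (phi k - phi l)%:C%C * (c k * G j (x - rint R k))))%R.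
  rewrite /synth -zsumZ; last exact: synth_asummable.
  rewrite addrC; apply/eqP; rewrite -subr_eq; apply/eqP.
  rewrite -zsumB.
  - by congr zsum; apply/funext => k; rewrite rmorphB mulrBl !mulrA.
  - under [X in asummable X]funext do rewrite -mulrA.
    by apply: zsum_weighted_asummable => // k; have /andP[? ?] := phi01 k; rewrite ger0_norm.
  - exact/asummableZ/synth_asummable.
apply: (@le_trans _ _ ((phi l)%:E * (modc (synth G c j x))%:E + (modc (zsum (fun k =>
    (phi k - phi l)%:C%C * (c k * G j (x - rint R k)))%R))%:E)).
  rewrite -EFinM -EFinD lee_fin (le_trans (modcD _ _))// Normc.normcM modc_real ger0_norm//.
  by case/andP: (phi01 l).
apply: leeD2l; apply: (@zsum_weighted_le c (fun k => phi k - phi l)%R) => // k.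
have /andP[? ?] := phi01 k; have /andP[? ?] := phi01 l.
by rewrite ler_norml; apply/andP; split; lra.
Qed.

(* The value 0 is added for the cells that contain no sampling point. *)
Definition cellsup Lam F (l : int) : \bar R :=
  ereal_sup [set y | y = 0 \/
    exists j x, [/\ Lam j x, Num.floor x = l & y = (modc (F j x))%:E]].

Lemma cellsup_ge0 Lam F l : 0 <= cellsup Lam F l.
Proof. by apply: ereal_sup_ubound; left. Qed.

Lemma cellsup_le Lam F l y : 0 <= y ->
  (forall j x, Lam j x -> Num.floor x = l -> (modc (F j x))%:E <= y) ->
  cellsup Lam F l <= y.
Proof. by move=> y0 H; apply: ge_ereal_sup => _ [->//|[j [x [? ? ->]]]]; exact: H. Qed.

Lemma cellsup_ub Lam F j x : Lam j x -> (modc (F j x))%:E <= cellsup Lam F (Num.floor x).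
Proof. by move=> Lx; apply: ereal_sup_ubound; right; exists j, x. Qed.

(** This is [D_commutator] for the sampled synthesis. The bound depends on [x] only through its
    cell, apart from the sample itself, so the supremum over a cell can be taken. *)
Lemma cellsup_commutator Lam c (phi : int -> R) l : lnorm +oo (cmod c) < +oo ->
  (forall k, 0 <= phi k <= 1)%R ->
  cellsup Lam (synth G (fun k => (phi k)%:C%C * c k)%R) l <=
  (phi l)%:E * cellsup Lam (synth G c) l +
  \esum_(n in [set: int]) ((w n * `|phi (l - n) - phi l|)%:E * cmod c (l - n)%R).
Proof.
move=> cy phi01; have p0 : (0 <= phi l)%R by case/andP: (phi01 l).
apply: cellsup_le.
  rewrite adde_ge0// ?mule_ge0 ?lee_fin ?cellsup_ge0//.
  by apply: esum_ge0 => n _; rewrite mule_ge0 ?cmod_ge0// lee_fin mulr_ge0.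
move=> j x Lx <-; apply: (le_trans (synth_commutator _ _ cy phi01)).
apply: leeD2r; apply: lee_wpmul2l; last exact: cellsup_ub.
by rewrite lee_fin; case/andP: (phi01 (Num.floor x)).
Qed.

(** Young's inequality for convolution with the l^1 kernel [w]; it yields the upper sampling
    bound. *)
Lemma lnorm_cellsup_synth p Lam c : 1 <= p -> lnorm p (cmod c) < +oo ->
  lnorm p (cellsup Lam (synth G c)) <=
  (\esum_(n in [set: int]) (w n)%:E) * lnorm p (cmod c).
Proof.
move=> p1 cp; have cy : lnorm +oo (cmod c) < +oo by exact: le_lt_trans (lnorm_le_oo _ p1) cp.
have wc0 n l : 0 <= (w n)%:E * cmod c (l - n)%R by rewrite mule_ge0 ?cmod_ge0// lee_fin.
apply: (@le_trans _ _ (lnorm p (fun l => \esum_(n in [set: int]) ((w n)%:E * cmod c (l - n)%R)))).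
  apply: le_lnorm => // l; first exact: cellsup_ge0.
  apply: cellsup_le; first exact: esum_ge0.
  by move=> j x _ <-; exact: synth_le.
apply: (le_trans (lnorm_esum 0%R p1 wc0)).
rewrite muleC; apply: le_trans (le_esumZl _ _ _); last 2 first.
- by apply: (lnorm_ge0 0%R) => // k; exact: cmod_ge0.
- by move=> n; rewrite lee_fin.
apply: le_esum => n _; rewrite [leRHS]muleC.
apply: (le_trans (lnormZ_le p1 (w0 n) (fun k => cmod_ge0 c (k - n)%R))).
by rewrite (lnorm_reindex p (cmod c) (bij_shift (- n)%R)).
Qed.

End synthesis.

(** * Sampling norms versus norms of cell suprema *)

Section sampling_norm.
Context {R : realType}.
Local Notation C := (complex R).
Local Notation modc := (@Normc.normc R).
Local Open Scope ereal_scope.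
Variable N : nat.
Implicit Types (Lam : 'I_N -> set R) (F : 'I_N -> R -> C).

Lemma esum_fibers (T I : choiceType) (f : T -> I) (A : set T) (a : T -> \bar R) :
  (forall x, 0 <= a x) ->
  \esum_(i in [set: I]) \esum_(x in A `&` [set x | f x = i]) a x = \esum_(x in A) a x.
Proof.
move=> a0; rewrite esum_esum//; apply/esym.
rewrite (@reindex_esum R _ _ ([set: I] `*`` (fun i => A `&` [set x | f x = i])) A (fun u => u.2))//.
split => [[i x] /= [_ []]//|[i x] [i' x']|x Ax]; last by exists (f x, x).
by rewrite !inE/= => -[_ [_ <-]] [_ [_ <-]] ->.
Qed.

(** Once [1 / m] is below the separation, [floor (x * m)] is injective on the set and takes at most
    [m] values on a unit cell. The count is phrased as the sum of a constant, ready for comparison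
    with sums over samples. *)
Lemma separated_cell (L : set R) : separated_set L -> exists m : nat,
  forall l (t : \bar R), 0 <= t ->
  \esum_(x in L `&` [set x | Num.floor x = l]) t <= m%:R%:E * t.
Proof.
move=> [d [d0 Hd]]; pose m := (Num.bound d^-1).+1.
have m0 : (0 < m%:R :> R)%R by rewrite ltr0n.
have dm : (m%:R^-1 < d)%R.
  rewrite -[ltRHS]invrK ltf_pV2 ?posrE ?invr_gt0//.
  by rewrite (lt_le_trans (archi_boundP _)) ?invr_ge0 ?(ltW d0)// /m ler_nat.
exists m => l t t0; set P := _ `&` _.
pose e (x : R) := (Num.floor (x * m%:R)).
have einj : set_inj P e.
  move=> x y; rewrite !inE => -[Lx _] [Ly _] exy; apply/eqP; apply/negPn/negP => xy.
  have := Hd _ _ Lx Ly xy; rewrite leNgt => /negP; apply.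
  apply: le_lt_trans dm; rewrite -[leRHS]mul1r ler_pdivlMr// -{1}(ger0_norm (ltW m0)) -normrM.
  have := floor_itv (x * m%:R); have := floor_itv (y * m%:R).
  rewrite -/(e x) -/(e y) exy !intrD => /andP[? ?] /andP[? ?].
  by rewrite ler_norml; apply/andP; split; lra.
rewrite -(esum_image P e (fun=> t))//.
apply: (@le_trans _ _ (\esum_(i in (fun i : nat => (l * m%:Z + i%:Z)%R) @` `I_m) t)).
  apply: le_esum_subset => // _ [x [Lx xl] <-].
  have /andP[] := floor_itv x; rewrite xl => h1 h2.
  have /andP[g1 g2] := floor_itv (x * m%:R).
  have e1 : (l * m%:Z <= e x)%R.
    rewrite -ltzD1 -(ltr_int R); apply: le_lt_trans g2.
    by rewrite intrM ler_wpM2r// ltW.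
  have e2 : (e x < (l + 1) * m%:Z)%R.
    by rewrite -(ltr_int R); apply: (le_lt_trans g1); rewrite intrM ltr_pM2r.
  exists (absz (e x - l * m%:Z)%R) => /=; lia.
rewrite esum_image; last by move=> i j _ _ /addrI[].
rewrite esum_fset//.
by rewrite -fsbig_ord sumr_const card_ord mule_natl.
Qed.

Lemma lnorm_cellsup_le p Lam F : 1 <= p -> lnorm p (cellsup Lam F) <= sampnorm p Lam F.
Proof.
elim/(@ge1_ind R) => [r r1|]; rewrite /lnorm /sampnorm; last first.
  apply: ge_ereal_sup => _ [l _ <-]; apply: cellsup_le.
    exact: bigmax_ge_id.
  move=> j x Lx _; apply: le_trans (le_bigmax _ _ j).
  by apply: ereal_sup_ubound; exists x.
have r0 : (0 < r)%R by lra.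
have p0 j x : 0 <= (modc (F j x))%:E `^ r by exact: poweR_ge0.
apply: lee_poweR; rewrite ?invr_ge0 ?(ltW r0)//.
  by apply: esum_ge0 => *; exact: poweR_ge0.
pose S l := \sum_(j < N) \esum_(x in Lam j `&` [set x | Num.floor x = l]) ((modc (F j x))%:E `^ r).
have S0 l : 0 <= S l by apply: sume_ge0 => j _; exact: esum_ge0.
apply: (@le_trans _ _ (\esum_(l in [set: int]) S l)).
  apply: le_esum => l _; rewrite -[leRHS](@poweRKV _ r)//.
  apply: lee_poweR; rewrite ?cellsup_ge0 ?(ltW r0)//.
  apply: cellsup_le; first exact: poweR_ge0.
  move=> j x Lx xl; rewrite -[leLHS](@poweRVK _ r) ?lee_fin ?modc_ge0//.
  apply: lee_poweR; rewrite ?invr_ge0 ?(ltW r0)//.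
  rewrite /S (bigD1 j)//; apply: (@le_trans _ _ (\esum_(x in Lam j `&` [set x | Num.floor x = l])
    ((modc (F j x))%:E `^ r))).
    exact: (@le_esum_term _ _ _ (fun x => (modc (F j x))%:E `^ r)).
  by apply: leeDl; apply: sume_ge0 => i _; exact: esum_ge0.
rewrite /S esum_sum//; last by move=> l j _ _; exact: esum_ge0.
by apply: lee_sum => j _; rewrite esum_fibers.
Qed.

Lemma sampnorm_oo_le Lam F : sampnorm +oo Lam F <= lnorm +oo (cellsup Lam F).
Proof.
apply: bigmax_le => [|j _].
  exact: (lnorm_ge0 0%R (leey _) (cellsup_ge0 _ _)).
apply: ge_ereal_sup => _ [x Lx <-]; apply: (le_trans (cellsup_ub _ Lx)).
by apply: ereal_sup_ubound; exists (Num.floor x).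
Qed.

Lemma sampnorm_le p Lam : 1 <= p -> (forall j, separated_set (Lam j)) ->
  exists2 K : R, (0 < K)%R & forall F, sampnorm p Lam F <= K%:E * lnorm p (cellsup Lam F).
Proof.
move=> + sep; elim/(@ge1_ind R) => [r r1|]; last first.
  by exists 1%R => // F; rewrite mul1e; exact: sampnorm_oo_le.
have r0 : (0 < r)%R by lra.
have [m Hm] := @choice _ _ _ (fun j => separated_cell (sep j)).
(* [M] bounds the number of samples in a cell over all components together; adding 1 below keeps the
   constant positive. *)
pose M : R := (\sum_(j < N) (m j)%:R)%R.
have M0 : (0 <= M)%R by apply: sumr_ge0.
exists ((M + 1) `^ r^-1)%R; first by rewrite powR_gt0// ltr_wpDl.
move=> F; rewrite /sampnorm /lnorm -poweR_EFin -poweRM ?lee_fin ?addr_ge0//; last first.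
  by apply: esum_ge0 => *; exact: poweR_ge0.
have p0 j x : 0 <= (modc (F j x))%:E `^ r by exact: poweR_ge0.
apply: lee_poweR; rewrite ?invr_ge0 ?(ltW r0)//.
  by apply: sume_ge0 => j _; exact: esum_ge0.
set S := \esum_(l in [set: int]) _; have S0 : 0 <= S by apply: esum_ge0 => *; exact: poweR_ge0.
apply: (@le_trans _ _ (M%:E * S)); last by apply: lee_wpmul2r => //; rewrite lee_fin lerDl.
rewrite /M -sumEFin ge0_sume_distrl; last by move=> j _; rewrite lee_fin.
apply: lee_sum => j _; rewrite -(esum_fibers (@Num.floor R))//.
rewrite -esumZl//; last by move=> l; exact: poweR_ge0.
apply: le_esum => l _; apply: le_trans (Hm _ _ _ _); last exact: poweR_ge0.
apply: le_esum => x [Lx xl]; apply: lee_poweR; rewrite ?(ltW r0)// ?lee_fin ?modc_ge0//.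
by rewrite -[in leRHS]xl; exact: cellsup_ub.
Qed.

Variables (G : 'I_N -> R -> C) (w : int -> R).
Hypothesis w0 : forall n, (0 <= w n)%R.
Hypothesis wy : \esum_(n in [set: int]) (w n)%:E < +oo.
Hypothesis Gw : forall j x, (modc (G j x) <= w (Num.floor x))%R.
Hypothesis stG : stable_shifts G.

(** Stability replaces the norm of [synth G c] by that of [c], and the sampling norm is comparable
    with the cell suprema. The comparison [HK] is a hypothesis because it has two sources:
    separation for [Lam], and [sampnorm_oo_le] with constant 1 for weak limits. *)
Lemma sampling_bounded_below p Lam (K : R) : 1 <= p -> (0 < K)%R ->
  (forall F, sampnorm p Lam F <= K%:E * lnorm p (cellsup Lam F)) ->
  sampling_set p G Lam <->
  bounded_below p (fun c => lnorm p (cmod c) < +oo) (fun c => cellsup Lam (synth G c)).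
Proof.
move=> p1 K0 HK; have [A1 [B1 [A10 [B10 st]]]] := stG p1.
split=> [[A [B [A0 [B0 H]]]]|[A A0 H]].
  exists ((A1 * A)^-1 * K)%R; first by rewrite mulr_gt0// invr_gt0 mulr_gt0.
  move=> c cp; have [st1 _] := st c cp.
  have [H1 _] := H (synth G c) (ex_intro _ c (conj cp erefl)).
  rewrite EFinM -muleA lee_pdivlMl ?mulr_gt0//.
  apply: le_trans (HK _); apply: le_trans H1.
  rewrite mulrC EFinM -muleA; apply: lee_wpmul2l => //; first by rewrite lee_fin ltW.
have [W WE] : exists W, \esum_(n in [set: int]) (w n)%:E = W%:E.
  have W0 : 0 <= \esum_(n in [set: int]) (w n)%:E by apply: esum_ge0 => *; rewrite lee_fin.
  by exists (fine (\esum_(n in [set: int]) (w n)%:E)); rewrite fineK// ge0_fin_numE.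
have W0 : (0 <= W)%R by rewrite -lee_fin -WE; apply: esum_ge0 => *; rewrite lee_fin.
exists ((B1 * A)^-1)%R, (K * (W + 1) * A1^-1)%R.
rewrite invr_gt0 !mulr_gt0 ?invr_gt0 ?(ltr_wpDl W0)//; split => //; split => //.
move=> _ [c [cp ->]]; have [st1 st2] := st c cp.
have c0 : 0 <= lnorm p (cmod c) by apply: (lnorm_ge0 0%R) => // *; exact: cmod_ge0.
split.
  rewrite -lee_pdivlMl ?invr_gt0 ?mulr_gt0// invrK.
  apply: (le_trans st2); rewrite EFinM -muleA; apply: lee_wpmul2l; first by rewrite lee_fin ltW.
  apply: (le_trans (H c cp)); apply: lee_wpmul2l; first by rewrite lee_fin ltW.
  exact: lnorm_cellsup_le.
apply: (le_trans (HK _)); rewrite -mulrA EFinM -muleA; apply: lee_wpmul2l.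
  by rewrite lee_fin ltW.
apply: (le_trans (lnorm_cellsup_synth w0 wy Gw Lam p1 cp)); rewrite WE EFinM -muleA.
apply: (@le_trans _ _ ((W + 1)%:E * lnorm p (cmod c))).
  by apply: lee_wpmul2r => //; rewrite lee_fin lerDl.
apply: lee_wpmul2l; first by rewrite lee_fin addr_ge0.
by rewrite lee_pdivlMl.
Qed.

End sampling_norm.

(** * Limits of points and of sets along an ultrafilter *)

Section ultralimits.
Context {R : realType}.
Local Notation C := (complex R).
Local Notation modc := (@Normc.normc R).
Variable U : set_system nat.
Hypothesis UU : UltraFilter U.

(** Compactness of the segment gives a cluster point, and a cluster point of an ultrafilter is a
    limit, since the ultrafilter decides every neighbourhood. *)
Lemma ultra_lim (u : nat -> R) (a b : R) : U [set n | a <= u n <= b] ->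
  exists2 x : R, a <= x <= b & forall e : R, 0 < e -> U [set n | `|u n - x| < e].
Proof.
move=> uab; have FF : ProperFilter (u @ U) by exact: fmap_proper_filter.
have FA : (u @ U) [set` `[a, b]].
  by apply: (@filterS _ U _ _ _ _ uab) => n abu; rewrite /preimage/= in_itv/=.
have [x [abx clx]] := segment_compact FF FA.
exists x; first by move: abx; rewrite /= in_itv.
move=> e e0; have [//|nU] := in_ultra_setVsetC [set n | `|u n - x| < e] UU.
have [|y [/= ny]] := clx [set y | ~ `|y - x| < e] (ball x e) _ (nbhsx_ballx x e e0).
  exact: nU.
by rewrite /ball/= distrC => /ny.
Qed.

(** Real and imaginary parts converge separately; adding their bounds gives the crude 2. *)
Lemma ultra_limC (u : nat -> C) : (forall n, modc (u n) <= 1) ->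
  exists2 z, modc z <= 2 & forall e : R, 0 < e -> U [set n | modc (u n - z) <= e].
Proof.
move=> u1.
have [|x /andP[x1 x2] Hx] := @ultra_lim (fun n => complex.Re (u n)) (-1) 1.
  by apply: filterE => n /=; rewrite -ler_norml (le_trans (Re_le_modc _)).
have [|y /andP[y1 y2] Hy] := @ultra_lim (fun n => complex.Im (u n)) (-1) 1.
  by apply: filterE => n /=; rewrite -ler_norml (le_trans (Im_le_modc _)).
exists (x +i* y)%C.
  apply: (le_trans (modc_le_ReIm _)) => /=.
  have : `|x| <= 1 by rewrite ler_norml x1.
  have : `|y| <= 1 by rewrite ler_norml y1.
  lra.
move=> e e0; have e20 : 0 < e / 2 by rewrite divr_gt0.
apply: filterS2 (Hx _ e20) (Hy _ e20) => n /= h1 h2.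
apply: (le_trans (modc_le_ReIm _)); move: h1 h2; case: (u n) => ? ? /=; lra.
Qed.

(** The Kuratowski limit of the sets [L n] along [U]; for an ultrafilter its upper and lower
    versions agree. *)
Definition ultra_set (L : nat -> set R) : set R :=
  [set x | forall e : R, 0 < e -> U [set n | exists2 y, L n y & `|y - x| < e]].

(** If an inclusion fails for [U]-almost all [n], the offending points [u n] lie in the segment and
    have a limit [x] along [U]. For the first inclusion [x] belongs to the limit set, yet [u n]
    comes close to it. *)
Lemma ultra_set_near (L : nat -> set R) (a b e : R) : 0 < e ->
  U [set n | (L n `&` `]a, b[ `<=` thicken (ultra_set L) e) /\
             (ultra_set L `&` `]a, b[ `<=` thicken (L n) e)].
Proof.
move=> e0; apply: filterI.
  have [//|nU] := in_ultra_setVsetC [set n | L n `&` `]a, b[ `<=` thicken (ultra_set L) e] UU.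
  have /choice[u Hu] : forall n, exists x, ~ (L n `&` `]a, b[ `<=` thicken (ultra_set L) e) ->
      [/\ L n x, a <= x <= b & ~ thicken (ultra_set L) e x].
    move=> n; have [?|/nonsubset[x [[Lx abx] nx]]] :=
      pselect (L n `&` `]a, b[ `<=` thicken (ultra_set L) e); first by exists 0.
    exists x => _; split => //; move: abx; rewrite /= in_itv/= => /andP[? ?].
    by rewrite !ltW.
  have [|x _ Hx] := @ultra_lim u a b; first by apply: filterS nU => n /= /Hu[].
  have Gx : ultra_set L x.
    move=> d d0; apply: filterS2 nU (Hx d d0) => n /= /Hu[Lu _ _] ux.
    by exists (u n).
  have [n /= [/Hu[_ _ nt] ux]] := filter_ex (filterI nU (Hx e e0)).
  by exfalso; apply: nt; exists x.
have [//|nU] := in_ultra_setVsetC [set n | ultra_set L `&` `]a, b[ `<=` thicken (L n) e] UU.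
have /choice[u Hu] : forall n, exists x, ~ (ultra_set L `&` `]a, b[ `<=` thicken (L n) e) ->
    [/\ ultra_set L x, a <= x <= b & ~ thicken (L n) e x].
  move=> n; have [?|/nonsubset[x [[Lx abx] nx]]] :=
    pselect (ultra_set L `&` `]a, b[ `<=` thicken (L n) e); first by exists 0.
  exists x => _; split => //; move: abx; rewrite /= in_itv/= => /andP[? ?].
  by rewrite !ltW.
have [|x _ Hx] := @ultra_lim u a b; first by apply: filterS nU => n /= /Hu[].
(* One [u m] near [x] is fixed first. It lies in the limit set, so [L n] has a point near it for
   [U]-almost all [n]; three steps of [e / 3] lead from [u n] to that point. *)
have e30 : 0 < e / 3 by rewrite divr_gt0.
have [m /= [/Hu[Lm _ _] umx]] := filter_ex (filterI nU (Hx _ e30)).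
have [n /= [[/Hu[_ _ nt] unx] [y Ly yum]]] :=
  filter_ex (filterI (filterI nU (Hx _ e30)) (Lm _ e30)).
exfalso; apply: nt; exists y => //.
have -> : u n - y = (u n - x) + (x - u m) + (u m - y) by ring.
rewrite (le_lt_trans (ler_normD _ _))// (le_lt_trans (lerD (ler_normD _ _) (lexx _)))//.
by move: umx yum; rewrite (distrC (u m) x) (distrC y); lra.
Qed.

(** A diagonal choice: the sets at index [phi m] are within [1 / (m + 1)] of their limits on []-m,
    m[]. Finitely many [j] are handled at once, so a single sequence serves all components, as [WZ]
    demands. *)
Lemma ultra_set_weak_cvg (N : nat) (L : 'I_N -> nat -> set R) :
  exists phi : nat -> nat, forall j, weak_cvg (fun m => L j (phi m)) (ultra_set (L j)).
Proof.
pose P (m : nat) j := [set n |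
  (L j n `&` `]- m%:R, m%:R[ `<=` thicken (ultra_set (L j)) m.+1%:R^-1) /\
  (ultra_set (L j) `&` `]- m%:R, m%:R[ `<=` thicken (L j n) m.+1%:R^-1)].
have /choice[phi Hphi] : forall m, exists n, forall j, P m j n.
  move=> m; have : U [set n | forall j, P m j n].
    by apply: filter_forall => j; apply: ultra_set_near; rewrite invr_gt0.
  by move=> /filter_ex.
exists phi => j a b e e0.
(* Beyond [T] the interval []-m, m[] contains []a, b[] and [1 / (m + 1)] is at most [e]. *)
pose T : R := `|a| + `|b| + e^-1.
have T0 : 0 <= T by rewrite !addr_ge0// invr_ge0 ltW.
exists (Num.bound T) => m Tm.
have Tm' : T < m%:R by rewrite (lt_le_trans (archi_boundP T0))// ler_nat.
have ab : `]a, b[ `<=` `]- m%:R, m%:R[.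
  move=> x /=; rewrite !in_itv/= => /andP[ax xb].
  have := ler_norm a; have := ler_norm (- a); have := ler_norm b; have := ler_norm (- b).
  have := normr_ge0 a; have := normr_ge0 b.
  have : 0 < e^-1 by rewrite invr_gt0.
  rewrite !normrN; move: Tm'; rewrite /T => *; apply/andP; split; lra.
have me : m.+1%:R^-1 <= e.
  rewrite -[leRHS]invrK lef_pV2 ?posrE ?invr_gt0//.
  have : e^-1 <= T by rewrite lerDr addr_ge0.
  have : m%:R <= m.+1%:R :> R by rewrite ler_nat.
  lra.
have th A x : thicken A m.+1%:R^-1 x -> thicken A e x.
  by move=> [y Ay xy]; exists y => //; exact: lt_le_trans me.
have [H1 H2] := Hphi m j.
by split => x [Lx /ab abx]; apply: th; [apply: H1|apply: H2].
Qed.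

(** Counterexample pairs at scale [1 / (n + 1)] have a common limit along [U], where continuity is
    contradicted. Only [x] is confined to the segment; [y] may leave it. *)
Lemma unif_cont_segment (f : R -> C) (T e : R) : \oo `<=` U -> 0 < e ->
  (forall x (d : R), 0 < d ->
    exists2 h : R, 0 < h & forall y, `|y - x| <= h -> modc (f x - f y) <= d) ->
  exists2 h : R, 0 < h & forall x y, `|x| <= T -> `|y - x| < h -> modc (f x - f y) <= e.
Proof.
move=> Uoo e0 cf; apply: contrapT => H.
have /choice[xy Hxy] : forall n : nat, exists xy : R * R,
    [/\ `|xy.1| <= T, `|xy.2 - xy.1| < n.+1%:R^-1 & e < modc (f xy.1 - f xy.2)].
  move=> n; apply: contrapT => Hn; apply: H.
  exists n.+1%:R^-1; first by rewrite invr_gt0.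
  move=> x y xT yx; rewrite leNgt; apply/negP => fe; apply: Hn.
  by exists (x, y).
have [|x _ Hx] := @ultra_lim (fun n => (xy n).1) (- T) T.
  by apply: filterE => n /=; rewrite -ler_norml; have [] := Hxy n.
have e20 : 0 < e / 2 by rewrite divr_gt0.
have [h h0 Hh] := cf x _ e20.
have h20 : 0 < h / 2 by rewrite divr_gt0.
have /filter_ex[n /= [nx nh]] :
    U ([set n | `|(xy n).1 - x| < h / 2] `&` [set n | n.+1%:R^-1 < h / 2]).
  apply: filterI; first exact: Hx.
  apply: Uoo; exact: near_infty_natSinv_lt (PosNum h20).
have [_ /lt_trans/(_ nh) h1 h2] := Hxy n.
have f1 : modc (f x - f (xy n).1) <= e / 2 by apply: Hh; lra.
have f2 : modc (f x - f (xy n).2) <= e / 2.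
  apply: Hh; have -> : (xy n).2 - x = ((xy n).2 - (xy n).1) + ((xy n).1 - x) by ring.
  by rewrite (le_trans (ler_normD _ _))//; lra.
have : modc (f (xy n).1 - f (xy n).2) <= e.
  have -> : f (xy n).1 - f (xy n).2 = (f x - f (xy n).2) + - (f x - f (xy n).1) by ring.
  by rewrite (le_trans (modcD _ _))// modcN; lra.
by rewrite leNgt h2.
Qed.

End ultralimits.

(** * A real number and its floor *)

Section floor_estimates.
Context {R : realType}.

Lemma floor_dist (x : R) : `|x - rint R (Num.floor x)| <= 1.
Proof.
have /andP[h1 h2] := floor_itv x; rewrite intrD in h2.
by rewrite /rint ler_norml; apply/andP; split; lra.
Qed.

Lemma absz_floor_le (x : R) : `|Num.floor x|%N%:R <= `|x| + 1.
Proof.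
rewrite -rint_absz -(subKr x (rint R (Num.floor x))) (le_trans (ler_normB _ _))//.
by rewrite lerD2l floor_dist.
Qed.

Lemma absz_floor_ge (x : R) : `|x| <= `|Num.floor x|%N%:R + 1.
Proof.
rewrite -rint_absz -{1}(subrK (rint R (Num.floor x)) x) addrC.
by rewrite (le_trans (ler_normD _ _))// lerD2l floor_dist.
Qed.

End floor_estimates.

(** * Finitely supported sequences and finite sums of continuous functions *)

Section finite_support.
Context {R : realType}.
Local Notation C := (complex R).
Local Notation modc := (@Normc.normc R).
Implicit Types (c : int -> C).

Lemma finsupp_modc_bounded c : finsupp c ->
  exists2 B : R, 0 <= B & forall k, modc (c k) <= B.
Proof.
move=> [K Kc]; exists (\sum_(0 <= i < (2 * K).+1) modc (c (i%:Z - K%:Z))).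
  by apply: sumr_ge0 => *; exact: modc_ge0.
move=> k; have [kK|kK] := leqP `|k| K; last first.
  by rewrite Kc// Normc.normc0; apply: sumr_ge0 => *; exact: modc_ge0.
rewrite (bigD1_seq (absz (k + K%:Z))) ?iota_uniq//=; last by rewrite mem_index_iota; lia.
rewrite (_ : (absz (k + K%:Z))%:Z - K%:Z = k); last by lia.
by rewrite lerDl; apply: sumr_ge0 => *; exact: modc_ge0.
Qed.

(** The sequence equals its own window around 0, so its l^p norm is one value of the function of [x]
    bounded by [lnorm_window] with [q = +oo]. *)
Lemma finsupp_lnorm p c : (1 <= p)%E -> finsupp c -> (lnorm p (cmod c) < +oo)%E.
Proof.
move=> p1 fc; have [B B0 cB] := finsupp_modc_bounded fc; have [K Kc] := fc.
have [X X0 HX] := @lnorm_window R K.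
have cX := HX _ _ _ p1 (leey _) (cmod_ge0 c).
apply: (@le_lt_trans _ _ (X%:E * lnorm +oo (cmod c))%E); last first.
  by rewrite lte_mul_pinfty// (modc_bounded cB).
apply: le_trans cX.
have W0 x k : (0 <= window (cmod c) K x k)%E by apply: window_ge0 => ?; exact: cmod_ge0.
apply: le_trans (lnorm_ge 0 (leey _) (fun x => lnorm_ge0 0 p1 (W0 x))).
apply: le_lnorm => // k; first exact: cmod_ge0.
rewrite /window subr0; case: leqP => // kK.
by rewrite /cmod Kc// Normc.normc0.
Qed.

Lemma sum_eps_delta (n : nat) (f : nat -> R -> C) x :
  (forall i (e : R), 0 < e ->
    exists2 h : R, 0 < h & forall y, `|y - x| <= h -> modc (f i x - f i y) <= e) ->
  forall e : R, 0 < e -> exists2 h : R, 0 < h & forall y, `|y - x| <= h ->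
    modc (\sum_(0 <= i < n) f i x - \sum_(0 <= i < n) f i y) <= e.
Proof.
move=> Hf; elim: n => [|n IH] e e0.
  by exists 1 => // y _; rewrite !big_geq// subrr Normc.normc0 ltW.
have e20 : 0 < e / 2 by rewrite divr_gt0.
have [h1 h10 H1] := IH _ e20; have [h2 h20 H2] := Hf n _ e20.
exists (Num.min h1 h2); first by rewrite lt_min h10.
move=> y; rewrite le_min => /andP[/H1 a1 /H2 a2].
rewrite !big_nat_recr//= opprD addrACA (le_trans (modcD _ _))//; lra.
Qed.

End finite_support.

(** * Continuity, covariance and decay of the synthesis *)

Section synth_continuity.
Context {R : realType}.
Local Notation C := (complex R).
Local Notation modc := (@Normc.normc R).
Variables (N : nat) (G : 'I_N -> R -> C) (w : int -> R).
Hypothesis w0 : forall n, 0 <= w n.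
Hypothesis wy : (\esum_(n in [set: int]) (w n)%:E < +oo)%E.
Hypothesis Gw : forall j x, modc (G j x) <= w (Num.floor x).
Hypothesis Gc : forall j, continuous (G j).
Implicit Types (c : int -> C).

(** The truncation order is uniform over all coefficients bounded by [B] and all [|x| <= X]: with
    [|floor x| <= M] and [|k| > m + M], the kernel is evaluated only beyond [m]. *)
Lemma synth_approx (B X e : R) : 0 <= B -> 0 < e -> exists K : nat,
  forall c, (forall k, modc (c k) <= B) -> forall j x, `|x| <= X ->
  modc (synth G c j x - zpsum (fun k => c k * G j (x - rint R k)) K) <= e.
Proof.
move=> B0 e0; have B1 : 0 < B + 1 by rewrite ltr_wpDl.
have w0E n : (0 <= (w n)%:E)%E by rewrite lee_fin.
have [m Hm] := esum_int_tail w0E wy (divr_gt0 e0 B1).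
pose M := Num.bound (`|X| + 1); exists (m + M)%N => c cB j x xX.
have cy := modc_bounded cB.
have lM : (`|Num.floor x| <= M)%N.
  rewrite -(ler_nat R) (le_trans (absz_floor_le x))//.
  have : `|X| + 1 < M%:R by apply: archi_boundP; rewrite addr_ge0.
  by have := ler_norm X; move: xX; lra.
set l := Num.floor x in lM.
rewrite -lee_fin; apply: (le_trans (zsum_tail _ (synth_asummable w0 wy Gw j x cy))).
set A := [set k : int | (m + M < `|k|)%N].
apply: (@le_trans _ _ (\esum_(k in A) ((B + 1)%:E * (w (l - k))%:E))%E).
  apply: le_esum => k _; rewrite -EFinM lee_fin Normc.normcM ler_pM ?modc_ge0//.
    by rewrite (le_trans (cB k))// lerDl.
  by have := Gw j (x - rint R k); rewrite floor_subz.
rewrite esumZl ?(ltW B1)//.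
rewrite -(esum_image A (fun k => l - k) (fun n => (w n)%:E)); last first.
  by move=> k k' _ _ /addrI/oppr_inj.
apply: (@le_trans _ _ ((B + 1)%:E * (e / (B + 1))%:E)%E); last first.
  by rewrite -EFinM lee_fin mulrC divfK ?gt_eqF.
apply: lee_wpmul2l; first by rewrite lee_fin ltW.
apply: le_trans Hm; apply: le_esum_subset => //.
by move=> _ [k /= Ak <-]; rewrite /A/= in Ak *; lia.
Qed.

Lemma G_eps_delta j x (e : R) : 0 < e ->
  exists2 h : R, 0 < h & forall y, `|y - x| <= h -> modc (G j x - G j y) <= e.
Proof.
move=> e0; have e0C : 0 < e%:C%C :> C by rewrite ltcE/= eqxx.
have Gx : G j y @[y --> x] --> G j x := @Gc j x.
have /cvgrPdist_le /(_ _ e0C) := Gx.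
move=> /nbhs_ballP[h /= h0 Hh]; exists (h / 2); first by rewrite divr_gt0.
move=> y yx; have /Hh : ball x h y.
  by rewrite /ball/= distrC (le_lt_trans yx)//; lra.
by rewrite /= normC_modc lecE/= => /andP[].
Qed.

(** Joint continuity in the point and in the coefficients, for coordinatewise convergence of bounded
    sequences. The four quarters of [e] pay for two truncations, moving the point in a finite sum,
    and changing finitely many coefficients. *)
Lemma synth_continuity c j x (B e : R) : 0 <= B -> (forall k, modc (c k) <= B) -> 0 < e ->
  exists (K : nat) (h : R), 0 < h /\ forall c', (forall k, modc (c' k) <= B) ->
    (forall k : int, (`|k| <= K)%N -> modc (c' k - c k) <= h) ->
    forall y, `|y - x| <= h -> modc (synth G c j x - synth G c' j y) <= e.
Proof.
move=> B0 cB e0; have e40 : 0 < e / 4 by rewrite divr_gt0.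
have [K HK] := synth_approx (`|x| + 1) B0 e40.
pose W := fine (\esum_(n in [set: int]) (w n)%:E)%E.
have W0 : (0 <= \esum_(n in [set: int]) (w n)%:E)%E by apply: esum_ge0 => *; rewrite lee_fin.
have wW n : w n <= W.
  rewrite -lee_fin fineK ?ge0_fin_numE//.
  exact: (@le_esum_term _ _ _ (fun n => (w n)%:E)).
have W0' : 0 <= W by exact: fine_ge0.
have [h1 h10 H1] : exists2 h : R, 0 < h & forall y, `|y - x| <= h ->
    modc (zpsum (fun k => c k * G j (x - rint R k)) K -
          zpsum (fun k => c k * G j (y - rint R k)) K) <= e / 4.
  apply: (@sum_eps_delta R _ (fun i y => c (i%:Z - K%:Z) * G j (y - rint R (i%:Z - K%:Z)))) => //.
  move=> i d d0; have B1 : 0 < B + 1 by rewrite ltr_wpDl.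
  have [h h0 Hh] := @G_eps_delta j (x - rint R (i%:Z - K%:Z)) _ (divr_gt0 d0 B1).
  exists h => // y yx; rewrite -mulrBr Normc.normcM.
  apply: (@le_trans _ _ ((B + 1) * (d / (B + 1)))); last by rewrite mulrC divfK ?gt_eqF.
  rewrite ler_pM ?modc_ge0//; first by rewrite (le_trans (cB _))// lerDl.
  by apply: Hh; rewrite opprB addrA subrK.
(* There are [2 * K + 1] coefficients, each multiplied by a value of modulus at most [W + 1]. *)
pose V := (2 * K).+1%:R * (W + 1).
have V0 : 0 < V by rewrite mulr_gt0// ltr_wpDl.
exists K, (Num.min (Num.min h1 1) (e / 4 / V)); split.
  by rewrite !lt_min h10 ltr01 divr_gt0.
move=> c' c'B cc' y; rewrite !le_min => /andP[/andP[yx1 yx2] yx3].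
have xX : `|x| <= `|x| + 1 by rewrite lerDl.
have yX : `|y| <= `|x| + 1.
  by rewrite -(subrK x y) (le_trans (ler_normD _ _))//; lra.
have a1 := HK c cB j x xX; have a2 := HK c' c'B j y yX; have a3 := H1 y yx1.
have a4 : modc (zpsum (fun k => c' k * G j (y - rint R k)) K -
                zpsum (fun k => c k * G j (y - rint R k)) K) <= e / 4.
  rewrite /zpsum -sumrB (le_trans (modc_sum _ _ _))//.
  apply: (@le_trans _ _ (\sum_(0 <= i < (2 * K).+1) (e / 4 / V * (W + 1)))).
    rewrite !big_nat; apply: ler_sum => i /andP[_ iK].
    rewrite -mulrBl Normc.normcM ler_pM ?modc_ge0//.
      have iK' : (absz (i%:Z - K%:Z)%R <= K)%N by move: iK; clear; lia.
      by have := cc' _ iK'; rewrite !le_min => /andP[].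
    apply: (le_trans (Gw _ _)); apply: (le_trans (wW _)); by rewrite lerDl.
  by rewrite sumr_const_nat subn0 -[leLHS]mulr_natr -mulrA [(W + 1) * _]mulrC -/V divfK ?gt_eqF.
have -> : synth G c j x - synth G c' j y =
  (synth G c j x - zpsum (fun k => c k * G j (x - rint R k)) K) +
  (zpsum (fun k => c k * G j (x - rint R k)) K - zpsum (fun k => c k * G j (y - rint R k)) K) +
  - (zpsum (fun k => c' k * G j (y - rint R k)) K - zpsum (fun k => c k * G j (y - rint R k)) K) +
  - (synth G c' j y - zpsum (fun k => c' k * G j (y - rint R k)) K) by ring.
rewrite (le_trans (modcD _ _))// modcN -lerBrDr (le_trans (modcD _ _))// modcN -lerBrDr.
by rewrite (le_trans (modcD _ _))//; lra.
Qed.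

Lemma synth_shift c j x (n : int) : (lnorm +oo (cmod c) < +oo)%E ->
  synth G (fun k => c (k + n)) j x = synth G c j (x + rint R n).
Proof.
move=> cy; rewrite /synth.
rewrite -[RHS](zsum_shift n); last exact: (synth_asummable w0 wy Gw).
congr zsum; apply/funext => k; congr (_ * G j _).
by rewrite /rint intrD; ring.
Qed.

Lemma synthZ c j x (t : C) : (lnorm +oo (cmod c) < +oo)%E ->
  synth G (fun k => t * c k) j x = t * synth G c j x.
Proof.
move=> cy; rewrite /synth -zsumZ; last exact: (synth_asummable w0 wy Gw).
by congr zsum; apply/funext => k; rewrite mulrA.
Qed.

(** Far from the support of [c], only kernel values in the tail meet nonzero coefficients. This
    controls the samples outside every bounded interval, where weak convergence says nothing. *)
Lemma synth_decay c (v : R) : finsupp c -> 0 < v ->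
  exists T : R, forall j x, T < `|x| -> modc (synth G c j x) <= v.
Proof.
move=> fc v0; have [B B0 cB] := finsupp_modc_bounded fc; have [K Kc] := fc.
have cy := modc_bounded cB; have B1 : 0 < B + 1 by rewrite ltr_wpDl.
have w0E n : (0 <= (w n)%:E)%E by rewrite lee_fin.
have [m Hm] := esum_int_tail w0E wy (divr_gt0 v0 B1).
exists (K + m).+2%:R => j x Tx.
have Kml : (K + m < `|Num.floor x|)%N.
  rewrite -(ltr_nat R); have := absz_floor_ge x; move: Tx; rewrite -addn2 natrD; lra.
set l := Num.floor x in Kml.
rewrite -lee_fin; apply: (le_trans (synth_le w0 wy Gw j x cy)).
apply: (@le_trans _ _ (\esum_(n in [set: int])
    (if n \in [set n : int | (m < `|n|)%N] then ((B + 1)%:E * (w n)%:E) else 0))%E).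
  apply: le_esum => n _; rewrite /cmod -!EFinM; case: ifPn => [_|].
    by rewrite lee_fin mulrC ler_wpM2r// (le_trans (cB _))// lerDl.
  rewrite notin_setE/= => /negP; rewrite -leqNgt => nm.
  by rewrite Kc ?Normc.normc0 ?mulr0//; lia.
rewrite -esum_mkcondl setIT esumZl ?(ltW B1)//.
apply: (@le_trans _ _ ((B + 1)%:E * (v / (B + 1))%:E)%E).
  by apply: lee_wpmul2l => //; rewrite lee_fin ltW.
by rewrite -EFinM lee_fin mulrC divfK ?gt_eqF.
Qed.

End synth_continuity.

(** * Passage to weak limits of the sampling sets *)

Section weak_limits.
Context {R : realType}.
Local Notation C := (complex R).
Local Notation modc := (@Normc.normc R).
Variables (N : nat) (G : 'I_N -> R -> C) (w : int -> R).
Hypothesis w0 : forall n, 0 <= w n.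
Hypothesis wy : (\esum_(n in [set: int]) (w n)%:E < +oo)%E.
Hypothesis Gw : forall j x, modc (G j x) <= w (Num.floor x).
Hypothesis Gc : forall j, continuous (G j).
Implicit Types (c : int -> C) (Lam Gam : 'I_N -> set R).

Local Notation frame_op Lam := (fun c => cellsup Lam (synth G c)).
Local Notation linfty := (fun c => (lnorm +oo (cmod c) < +oo)%E).

Lemma nat_ultrafilter : exists2 U : set_system nat, UltraFilter U & \oo `<=` U.
Proof. by have [U [UU oU]] := ultraFilterLemma (eventually_filter); exists U. Qed.

(** If [c] had too small samples on [Gam], a translate would have too small samples on [Lam]: on a
    bounded interval translated points of [Lam] are close to [Gam] and uniform continuity applies,
    and outside it the synthesis decays. *)
Lemma WZ_bounded_below Lam Gam : WZ Lam Gam ->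
  bounded_below +oo linfty (frame_op Lam) -> bounded_below +oo finsupp (frame_op Gam).
Proof.
move=> [kn Hkn] [A A0 HA]; have [U UU Uoo] := nat_ultrafilter.
exists (2 * A); first by rewrite mulr_gt0.
move=> c fc; have cy : (lnorm +oo (cmod c) < +oo)%E by apply: finsupp_lnorm => //; exact: leey.
have c0 : (0 <= lnorm +oo (cmod c))%E.
  exact: (lnorm_ge0 0 (leey _) (cmod_ge0 c)).
have t0 : (0 <= lnorm +oo (cellsup Gam (synth G c)))%E.
  exact: (lnorm_ge0 0 (leey _) (cellsup_ge0 _ _)).
rewrite leNgt; apply/negP => Hlt.
have tfin : lnorm +oo (cellsup Gam (synth G c)) \is a fin_num.
  rewrite ge0_fin_numE// ltey; apply/eqP => ty; move: Hlt.
  by rewrite ty gt0_muley ?lte_fin ?mulr_gt0// ltNge leey.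
have [t tE] : exists t, lnorm +oo (cellsup Gam (synth G c)) = t%:E.
  by exists (fine (lnorm +oo (cellsup Gam (synth G c)))); rewrite fineK.
have [s sE] : exists s, lnorm +oo (cmod c) = s%:E.
  by exists (fine (lnorm +oo (cmod c))); rewrite fineK// ge0_fin_numE.
move: Hlt c0 t0; rewrite tE sE -EFinM lte_fin !lee_fin => Hlt s0 t0.
(* The doubled constant leaves room: [v] exceeds the samples on [Gam], while [A * v] is only half of
   [s]. *)
pose v := s / (2 * A).
have tv : t < v by rewrite /v ltr_pdivlMr ?mulr_gt0// mulrC.
have v0 : 0 < v by exact: le_lt_trans tv.
have sAv : A * v < s.
  have : v * (2 * A) = s by rewrite /v divfK// gt_eqF// mulr_gt0.
  by have := mulr_gt0 A0 v0; lra.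
have Gt j x : Gam j x -> modc (synth G c j x) <= t.
  move=> Gx; rewrite -lee_fin -tE; apply: (le_trans (cellsup_ub _ Gx)).
  by apply: ereal_sup_ubound; exists (Num.floor x).
have [B B0 cB] := bounded_modc cy.
have [T HT] := synth_decay w0 wy Gw fc v0.
have /choice[n0 Hn0] : forall j, exists n0, forall n, (n0 <= n)%N ->
    forall x, Lam j x -> modc (synth G c j (x + rint R (kn n))) <= v.
  move=> j; have vt0 : 0 < v - t by rewrite subr_gt0.
  have [|h h0 Hh] := @unif_cont_segment R U UU (synth G c j) T _ Uoo vt0.
    move=> x d d0; have [K [h [h0 Hh]]] := synth_continuity w0 wy Gw Gc j x B0 cB d0.
    exists h => // y yx; apply: Hh => // k _.
    by rewrite subrr Normc.normc0 ltW.
  have [n0 Hn] := Hkn j (- (`|T| + 1)) (`|T| + 1) _ h0; exists n0 => n /Hn[H1 _] x Lx.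
  set y := x + _; have [yT|yT] := leP `|y| T; last exact: HT.
  have [|z Gz yz] := H1 y.
    split; first by exists x.
    rewrite /= in_itv/= -ltr_norml; have := ler_norm T; move: yT; lra.
  have zy : `|z - y| < h by rewrite distrC.
  have := Hh _ _ yT zy; have := Gt _ _ Gz.
  have := modcD (synth G c j y - synth G c j z) (synth G c j z); rewrite subrK; lra.
pose n := (\max_(j < N) n0 j)%N.
pose c' k := c (k + kn n).
have c'y : (lnorm +oo (cmod c') < +oo)%E by apply: (@modc_bounded _ _ B) => k; exact: cB.
have c's : lnorm +oo (cmod c') = s%:E.
  by rewrite -sE -(lnorm_reindex +oo (cmod c) (bij_shift (kn n))).
have := HA _ c'y; rewrite c's leNgt => /negP; apply.
apply: (@le_lt_trans _ _ (A%:E * v%:E)%E); last by rewrite -EFinM lte_fin.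
apply: lee_wpmul2l; first by rewrite lee_fin ltW.
apply: ge_ereal_sup => _ [l _ <-]; apply: cellsup_le; first by rewrite lee_fin ltW.
move=> j x Lx _; rewrite (synth_shift w0 wy Gw)// lee_fin; apply: Hn0 => //.
exact: leq_bigmax.
Qed.

(** A sequence violating the constant [n + 1] is divided by its supremum, and an index where half of
    that supremum is exceeded is moved to 0. The lower bound at 0 prevents the limit from
    vanishing. *)
Lemma not_bounded_below_seq Lam : ~ bounded_below +oo linfty (frame_op Lam) ->
  exists (d : nat -> int -> C) (kn : nat -> int), forall n,
    [/\ forall k, modc (d n k) <= 1, 1 / 2 <= modc (d n 0) &
        forall j x, Lam j x -> modc (synth G (d n) j (x - rint R (kn n))) <= n.+1%:R^-1].
Proof.
move=> nb; suff /choice[dk Hdk] : forall n : nat, exists dk : (int -> C) * int,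
    [/\ forall k, modc (dk.1 k) <= 1, 1 / 2 <= modc (dk.1 0) &
        forall j x, Lam j x -> modc (synth G dk.1 j (x - rint R dk.2)) <= n.+1%:R^-1].
  by exists (fun n => (dk n).1), (fun n => (dk n).2).
move=> n.
have n0 : 0 < n.+1%:R :> R by rewrite ltr0n.
have [c cy Hc] : exists2 c, (lnorm +oo (cmod c) < +oo)%E &
    (n.+1%:R%:E * lnorm +oo (cellsup Lam (synth G c)) < lnorm +oo (cmod c))%E.
  apply: contrapT => H; apply: nb; exists n.+1%:R => // c cy.
  by rewrite leNgt; apply/negP => Hlt; apply: H; exists c.
have c0 : (0 <= lnorm +oo (cmod c))%E.
  exact: (lnorm_ge0 0 (leey _) (cmod_ge0 c)).
have t0 : (0 <= lnorm +oo (cellsup Lam (synth G c)))%E.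
  exact: (lnorm_ge0 0 (leey _) (cellsup_ge0 _ _)).
have [s sE] : exists s, lnorm +oo (cmod c) = s%:E.
  by exists (fine (lnorm +oo (cmod c))); rewrite fineK// ge0_fin_numE.
have s0 : 0 < s.
  by rewrite -lte_fin -sE; apply: le_lt_trans Hc; rewrite mule_ge0// lee_fin ltW.
have cs k : modc (c k) <= s.
  by rewrite -lee_fin -sE; exact: (lnorm_ge k (leey _) (cmod_ge0 c)).
have [k0 Hk0] : exists k0, s / 2 < modc (c k0).
  apply: contrapT => H; have : (lnorm +oo (cmod c) <= (s / 2)%:E)%E.
    apply: ge_ereal_sup => _ [k _ <-]; rewrite lee_fin leNgt; apply/negP => Hlt.
    by apply: H; exists k.
  rewrite sE lee_fin; lra.
pose ck k := c (k + k0).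
have cky : (lnorm +oo (cmod ck) < +oo)%E by apply: (@modc_bounded _ _ s) => k; exact: cs.
have mZ z : modc ((s^-1)%:C%C * z) = modc z / s.
  by rewrite Normc.normcM modc_real ger0_norm ?invr_ge0 ?(ltW s0)// mulrC.
exists (fun k => (s^-1)%:C%C * ck k, k0); split => /=.
- by move=> k; rewrite mZ ler_pdivrMr// mul1r; exact: cs.
- by rewrite mZ ler_pdivlMr// /ck add0r mul1r mulrC ltW.
- move=> j x Lx; rewrite (synthZ w0 wy Gw)// (synth_shift w0 wy Gw)// subrK mZ ler_pdivrMr//.
  rewrite mulrC ler_pdivlMr// mulrC -lee_fin EFinM -sE; apply: le_trans (ltW Hc).
  apply: lee_wpmul2l; first by rewrite lee_fin ltW.
  apply: (le_trans (cellsup_ub _ Lx)).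
  by apply: ereal_sup_ubound; exists (Num.floor x).
Qed.

Lemma synth_inj c : stable_shifts G -> (lnorm +oo (cmod c) < +oo)%E ->
  (vLnorm +oo (synth G c) <= 0)%E -> forall k, c k = 0.
Proof.
move=> stG cy c0 k; have [A [B [A0 [_ /(_ c cy)[H _]]]]] := stG +oo%E (leey _).
have := le_trans H c0; rewrite pmule_rle0 ?lte_fin// => H0.
apply: Normc.eq0_normc; apply/eqP; rewrite eq_le modc_ge0 andbT -lee_fin.
by apply: le_trans H0; exact: (lnorm_ge k (leey _) (cmod_ge0 c)).
Qed.

Lemma vLnorm_oo0 (F : 'I_N -> R -> C) : (forall j x, F j x = 0) -> (vLnorm +oo F <= 0)%E.
Proof.
move=> F0; rewrite /vLnorm; apply: bigmax_le => // j _.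
rewrite (_ : (fun x => (modc (F j x))%:E) = cst 0%E) ?Lnorm0//.
by apply/funext => x; rewrite F0 Normc.normc0.
Qed.

(** The norm of [F] is an essential supremum, so its vanishing alone concerns almost every point.
    Passing to the coefficients, which vanish by stability, gives every point. *)
Lemma sampling_uniqueness Gam : stable_shifts G ->
  sampling_set +oo%E G Gam -> uniqueness_set +oo%E G Gam.
Proof.
move=> stG [A [B [A0 [_ H]]]] F FV F0 j x.
have [HF _] := H F FV; case: FV => e [ey FE].
have e0 : forall k, e k = 0.
  apply: synth_inj => //; rewrite -FE -(@pmule_rle0 _ A%:E) ?lte_fin//.
  apply: (le_trans HF); apply: bigmax_le => // i _.
  by apply: ge_ereal_sup => _ [y Gy <-]; rewrite F0// Normc.normc0.
rewrite FE (_ : e = fun k => 0 * e k); last by apply/funext => k; rewrite mul0r e0.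
by rewrite (synthZ w0 wy Gw)// mul0r.
Qed.

(** The normalised sequences converge coordinatewise along [U], and the translates of [Lam] converge
    weakly to their limit sets. Joint continuity makes the limit synthesis vanish there, so
    uniqueness and stability force [c = 0], against the lower bound at index 0. *)
Lemma uniqueness_bounded_below Lam : stable_shifts G ->
  (forall Gam, WZ Lam Gam -> uniqueness_set +oo%E G Gam) ->
  bounded_below +oo linfty (frame_op Lam).
Proof.
move=> stG Hd; apply: contrapT => /not_bounded_below_seq[d [kn Hdk]].
have [U UU Uoo] := nat_ultrafilter.
have /choice[c Hc] : forall k, exists z, modc z <= 2 /\
    forall e : R, 0 < e -> U [set n | modc (d n k - z) <= e].
  move=> k; have [|z z2 Hz] := @ultra_limC R U UU (fun n => d n k); last by exists z.
  by move=> n; have [] := Hdk n.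
have c2 k : modc (c k) <= 2 by have [] := Hc k.
have d2 n k : modc (d n k) <= 2.
  by have [d1 _ _] := Hdk n; rewrite (le_trans (d1 k))//; lra.
have cy := modc_bounded c2.
(* The sign matches [not_bounded_below_seq], where [d n] is small at [x - kn n] for [x] in
   [Lam j]. *)
pose L j n := [set l + rint R (- kn n) | l in Lam j].
have [phi Hphi] := ultra_set_weak_cvg UU L.
have WG : WZ Lam (fun j => ultra_set U (L j)) by exists (fun m => - kn (phi m)).
have cG j x : ultra_set U (L j) x -> synth G c j x = 0.
  move=> Gx; apply: Normc.eq0_normc; apply/eqP; rewrite eq_le modc_ge0 andbT.
  apply/ler_addgt0Pr => e e0; rewrite add0r.
  have e20 : 0 < e / 2 by rewrite divr_gt0.
  have [K [h [h0 Hh]]] := synth_continuity w0 wy Gw Gc j x (ler0n R 2) c2 e20.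
  (* The indices [|k| <= K] are enumerated by a finite type so that finitely many members of [U] can
     be intersected. *)
  have UK : U [set n | forall i : 'I_(2 * K).+1, modc (d n (i%:Z - K%:Z) - c (i%:Z - K%:Z)) <= h].
    by apply: filter_forall => i; have [_] := Hc (i%:Z - K%:Z); apply.
  have Ue : U [set n | n.+1%:R^-1 < e / 2].
    by apply: Uoo; exact: near_infty_natSinv_lt (PosNum e20).
  have [n /= [[nK [y [l Ll <-] yx]] ne]] := filter_ex (filterI (filterI UK (Gx _ h0)) Ue).
  have [_ _ /(_ j l Ll) dn] := Hdk n.
  have := Hh (d n) (d2 n) _ _ (ltW yx).
  rewrite {1}/rint mulrNz -/(rint R (kn n)) => /(_ _) Hn.
  have {}Hn : modc (synth G c j x - synth G (d n) j (l - rint R (kn n))) <= e / 2.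
    apply: Hn => k kK.
    have kK' : (absz (k + K%:Z)%R < (2 * K).+1)%N by move: kK; clear; lia.
    have := nK (Ordinal kK') => /=; rewrite (_ : (absz (k + K%:Z))%:Z - K%:Z = k)//.
    by move: kK; clear; lia.
  have := modcD (synth G c j x - synth G (d n) j (l - rint R (kn n)))
    (synth G (d n) j (l - rint R (kn n))).
  by rewrite subrK; move: (le_lt_trans dn ne) Hn; lra.
have F0 := Hd _ WG (synth G c) (ex_intro _ c (conj cy erefl)) cG.
have c00 := synth_inj stG cy (vLnorm_oo0 F0) 0.
have [_ /(_ (1 / 4))] := Hc 0; rewrite c00 => /(_ _)/filter_ex[|n /=]; first by lra.
by rewrite subr0; have [_ + _] := Hdk n; lra.
Qed.

End weak_limits.

(** * The equivalence of the four sampling conditions *)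

Theorem theorem2p1 (R : realType) (N : nat) (G : 'I_N -> R -> complex R)
    (Lam : 'I_N -> set R) :
  (forall j, W0 (G j)) -> stable_shifts G -> (forall j, separated_set (Lam j)) ->
  let a := exists p : \bar R, (1 <= p)%E /\ sampling_set p G Lam in
  let b := forall p : \bar R, (1 <= p)%E -> sampling_set p G Lam in
  let c := forall Gam, WZ Lam Gam -> sampling_set +oo%E G Gam in
  let d := forall Gam, WZ Lam Gam -> uniqueness_set +oo%E G Gam in
  (a <-> b) /\ (a <-> c) /\ (a <-> d).
Proof.
move=> HG stG sep a b c d.
have [w [w0 wy Gw]] := W0_majorant HG.
have Gc j : continuous (G j) by have [] := HG j.
have transfer Gam p q := @bounded_below_transfer R w (fun c => cellsup Gam (synth G c)) w0 wy
  (fun _ _ => cellsup_ge0 _ _ _) (fun _ _ _ => cellsup_commutator w0 wy Gw Gam _) p q.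
have sampP p : (1 <= p)%E -> sampling_set p G Lam <->
    bounded_below p (fun c => (lnorm p (cmod c) < +oo)%E) (fun c => cellsup Lam (synth G c)).
  move=> p1; have [K K0 HK] := sampnorm_le p1 sep.
  exact: (sampling_bounded_below w0 wy Gw stG p1 K0 HK).
have sampooP Gam : sampling_set +oo%E G Gam <->
    bounded_below +oo (fun c => (lnorm +oo (cmod c) < +oo)%E) (fun c => cellsup Gam (synth G c)).
  apply: (sampling_bounded_below w0 wy Gw stG (leey _) ltr01) => F.
  by rewrite mul1e; exact: sampnorm_oo_le.
have ab : a -> b.
  move=> [p [p1 /(sampP _ p1) [A A0 HA]]] q q1; apply/(sampP _ q1).
  apply: (transfer _ p) => //; exists A => // e fe; apply: HA; exact: finsupp_lnorm.
have ba : b -> a by move=> Hb; exists +oo%E; split; [exact: leey|exact/Hb/leey].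
have bc : b -> c.
  move=> Hb Gam WG; apply/sampooP.
  (* The exponent stays at infinity; the transfer enlarges the test class from finitely supported to
     all bounded sequences. *)
  apply: (transfer _ +oo%E) => //; try exact: leey.
  by apply: (WZ_bounded_below w0 wy Gw Gc WG); apply/sampP; [exact: leey|exact/Hb/leey].
have cd : c -> d by move=> Hc Gam /Hc; exact: (sampling_uniqueness w0 wy Gw).
have da : d -> a.
  move=> Hd; exists +oo%E; split; first exact: leey.
  by apply/sampooP; exact: (uniqueness_bounded_below w0 wy Gw Gc stG).
by split; [|split]; split; auto.
Qed.
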